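(* Let $K$ be a (non-empty) compact Hausdorff space. Then for any ordinal $\xi$, the Banach space $C(K)$ admits an equivalent $\xi$-asymptotically uniformly flat norm if and only if the Cantor-Bendixson index of $K$ is less than $\omega^{\xi+1}$.
   Context: Banach spaces are over $\mathbb{K}\in\{\mathbb{R},\mathbb{C}\}$; $C(K)$ is the space of continuous $\mathbb{K}$-valued functions on $K$ with the supremum norm; $B_X$ is the closed unit ball. Cantor-Bendixson index. For closed $L\subset K$, $L'$ is the set of points of $L$ not isolated relative to $L$. $K^0=K$, $K^{\xi+1}=(K^\xi)'$, $K^\xi=\bigcap_{\zeta<\xi}K^\zeta$ for limit $\xi$. If some $K^\xi=\varnothing$ ($K$ is scattered), $CB(K)$ is the least such $\xi$; otherwise $CB(K)=\infty$, regarded as larger than every ordinal. Trees. A tree on a set $\Lambda$ is a set $T$ of non-empty finite sequences in $\Lambda$ closed under taking non-empty initial segments; $s<t$ means $s$ is a proper initial segment of $t$; $MAX(T)$ is the set of members with no proper extension in $T$. $T^0=T$, $T^{\zeta+1}=T^\zeta\setminus MAX(T^\zeta)$, $T^\zeta=\bigcap_{\eta<\zeta}T^\eta$ for limit $\zeta$; $o(T)$ is the least $\zeta$ with $T^\zeta=\varnothing$ (if it exists). For a directed set $D$, $T.D=\{(\zeta_i,u_i)_{i=1}^n:(\zeta_i)_{i=1}^n\in T,\ u_i\in D\}$ (sequences of pairs). A collection $(x_t)_{t\in T.D}$ in a Banach space is weakly null if for every $t\in T.D\cup\{\varnothing\}$ and every $\zeta$ with $\{t\frown(\zeta,u):u\in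 D\}\subset T.D$ (where $\frown$ is concatenation), the net $(x_{t\frown(\zeta,u)})_{u\in D}$ is weakly null. Modulus. For a non-zero operator (continuous linear map) $A:X\to Y$ and $\sigma>0$, $\varrho_\xi(\sigma,A)=\sup\inf\{\|y+Ax\|-1: t\in T.D,\ x\in \mathrm{co}(x_s:\varnothing<s\leqslant t)\}$, the supremum over all $y\in B_Y$, all trees $T$ with $o(T)=\omega^\xi$, all directed sets $D$ and all weakly null $(x_t)_{t\in T.D}\subset\sigma B_X$; $\varrho_\xi(\sigma,0)=0$. $A$ is $\xi$-asymptotically uniformly flat if $\varrho_\xi(\sigma,A)=0$ for some $\sigma>0$. A Banach space (with a given norm) is $\xi$-asymptotically uniformly flat if its identity operator is; an equivalent norm $|\cdot|$ on $X$ is $\xi$-asymptotically uniformly flat if $(X,|\cdot|)$ is. *)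

(* Defs.v *)
From HB Require Import structures.
From mathcomp Require Import all_boot all_order all_algebra.
From mathcomp Require Import complex.
From mathcomp Require Import all_classical all_reals all_analysis.

Set Implicit Arguments.
Unset Strict Implicit.
Unset Printing Implicit Defensive.

Import Order.TTheory GRing.Theory Num.Theory.
Import numFieldNormedType.Exports.

Local Open Scope classical_set_scope.
Local Open Scope ring_scope.

(* Classically, this type ordered by [ole] is a total well-founded preorder
   whose quotient by [ole a b /\ ole b a] is the class of all ordinals of the
   given universe: the element [v] of a well-order is represented by the
   supremum of [OZero] and of the successors of the elements below [v].
   [OSup i0 f] is the supremum of the family [f]; the point [i0] makes the
   family non-empty. The family need not be increasing and its supremum may be
   attained, so a clause for [OSup] plays the role of the clause for limit
   ordinals as soon as the function being defined is monotone. *)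
Inductive ord : Type :=
| OZero
| OSucc of ord
| OSup (I : Type) of I & (I -> ord).

Fixpoint ole (a : ord) : ord -> Prop :=
  match a with
  | OZero => fun=> True
  | OSucc a' => fix lt_a' (b : ord) : Prop :=
      match b with
      | OZero => False
      | OSucc b' => ole a' b'
      | OSup _ _ g => exists i, lt_a' (g i)
      end
  | OSup _ _ f => fun b => forall i, ole (f i) b
  end.

Definition olt (a b : ord) : Prop := ole (OSucc a) b.

Fixpoint oadd (a b : ord) : ord :=
  match b with
  | OZero => a
  | OSucc b' => OSucc (oadd a b')
  | OSup _ i0 g => OSup i0 (fun i => oadd a (g i))
  end.

Fixpoint omul (a b : ord) : ord :=
  match b with
  | OZero => OZero
  | OSucc b' => oadd (omul a b') a
  | OSup _ i0 g => OSup i0 (fun i => omul a (g i))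
  end.

Fixpoint oexp (a b : ord) : ord :=
  match b with
  | OZero => OSucc OZero
  | OSucc b' => omul (oexp a b') a
  | OSup _ i0 g => OSup i0 (fun i => oexp a (g i))
  end.

Definition omega : ord := OSup 0%N (fun n => iter n OSucc OZero).

(* Used for operations [d] with [d B `<=` B] and monotone for inclusion, so that
   equivalent representations of an ordinal give the same set. *)
Fixpoint derivative (U : Type) (d : set U -> set U) (A : set U) (a : ord) :
    set U :=
  match a with
  | OZero => A
  | OSucc b => d (derivative d A b)
  | OSup _ _ f => \bigcap_i derivative d A (f i)
  end.

Definition vanishes_first (U : Type) (d : set U -> set U) (A : set U)
    (a : ord) : Prop :=
  derivative d A a = set0 /\ forall b, olt b a -> derivative d A b <> set0.

Definition CB_derivative (K : topologicalType) (L : set K) : set K :=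
  L `\` isolated L.

Definition has_CB_index (K : topologicalType) (a : ord) : Prop :=
  vanishes_first (@CB_derivative K) [set: K] a.

(* A space without index has [CB(K) = oo], which is below no ordinal. *)
Definition CB_index_lt (K : topologicalType) (b : ord) : Prop :=
  exists a, has_CB_index K a /\ olt a b.

Section Trees.
Variable Lambda : Type.
Implicit Types (T : set (seq Lambda)) (s t : seq Lambda).

Definition initial_segment s t : Prop := exists u, t = s ++ u.

Definition is_tree T : Prop :=
  (forall t, T t -> t <> [::]) /\
  (forall s t, T t -> s <> [::] -> initial_segment s t -> T s).

Definition MAX T : set (seq Lambda) :=
  [set t | T t /\ forall s, T s -> initial_segment t s -> s = t].

Definition has_tree_order T (a : ord) : Prop :=
  vanishes_first (fun S => S `\` MAX S) T a.

End Trees.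

Record directed_set := DirectedSet {
  dcarrier :> Type;
  dle : dcarrier -> dcarrier -> Prop;
  dinhabited : inhabited dcarrier;
  dle_refl : forall u, dle u u;
  dle_trans : forall u v w, dle u v -> dle v w -> dle u w;
  dle_directed : forall u v, exists w, dle u w /\ dle v w }.

Definition tails (D : directed_set) : set_system D :=
  filter_from [set: D] (fun u0 => [set u | dle u0 u]).
Arguments tails : clear implicits.

Definition tree_dir (Lambda : Type) (T : set (seq Lambda)) (D : directed_set) :
    set (seq (Lambda * D)) :=
  [set t | T (unzip1 t)].
Arguments tree_dir {Lambda} T D.

Section Modulus.
Variable F : numFieldType.

Definition weakly_null_net (X : normedModType F) (D : directed_set)
    (z : D -> X) : Prop :=
  forall f : {linear X -> F^o}, continuous f ->
    (fun u => f (z u)) @ tails D --> (0 : F^o).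

(* Only the values of [x] on [tree_dir T D] matter. *)
Definition weakly_null_collection (X : normedModType F) (Lambda : Type)
    (T : set (seq Lambda)) (D : directed_set)
    (x : seq (Lambda * D) -> X) : Prop :=
  forall t, tree_dir T D t \/ t = [::] ->
  forall zeta, (forall u, tree_dir T D (rcons t (zeta, u))) ->
    weakly_null_net (fun u => x (rcons t (zeta, u))).

Definition convex_hull (V : lmodType F) (A : set V) : set V :=
  [set v | exists n (w : 'I_n -> F) (a : 'I_n -> V),
    [/\ forall i, 0 <= w i, \sum_(i < n) w i = 1, forall i, A (a i)
      & v = \sum_(i < n) w i *: a i]].

Definition branch (X S : Type) (x : seq S -> X) (t : seq S) : set X :=
  x @` [set s | s <> [::] /\ initial_segment s t].

(* Suprema and infima are taken in [F] itself, whose order is partial when [F]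
   is the field of complex numbers. There a number comparable with a real
   number is real, so that for a non-empty set of real numbers the bounds in
   [F] are the bounds in the real line. The sets below are non-empty and
   bounded when [A] is a non-zero continuous operator. *)
Definition rho (xi : ord) (X Y : normedModType F) (sigma : F)
    (A : {linear X -> Y}) : F :=
  if `[< forall v, A v = 0 >] then 0 else
  supremum 0 [set r | exists (y : Y) (Lambda : Type) (T : set (seq Lambda))
                        (D : directed_set) (x : seq (Lambda * D) -> X),
    [/\ `|y| <= 1,
        is_tree T /\ has_tree_order T (oexp omega xi),
        forall t, tree_dir T D t -> `|x t| <= sigma,
        weakly_null_collection T x
      & r = infimum 0 [set `|y + A v| - 1 |
              v in \bigcup_(t in tree_dir T D) convex_hull (branch x t)]]].

Definition auf_operator (xi : ord) (X Y : normedModType F)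
    (A : {linear X -> Y}) : Prop :=
  exists sigma : F, 0 < sigma /\ rho xi sigma A = 0.

Definition auf_space (xi : ord) (X : normedModType F) : Prop :=
  auf_operator xi (idfun : {linear X -> X}).

End Modulus.

Record norm_on (F : numFieldType) (V : lmodType F) := NormOn {
  norm_fun :> V -> F;
  norm_triangle : forall u v, norm_fun (u + v) <= norm_fun u + norm_fun v;
  norm_scale : forall (a : F) v, norm_fun (a *: v) = `|a| * norm_fun v;
  norm_eq0 : forall v, norm_fun v = 0 -> v = 0 }.

Definition renormed (F : numFieldType) (V : lmodType F) (N : norm_on V) : Type :=
  V.

HB.instance Definition _ (F : numFieldType) (V : lmodType F) (N : norm_on V) :=
  GRing.Lmodule.on (renormed N).
HB.instance Definition _ (F : numFieldType) (V : lmodType F) (N : norm_on V) :=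
  Lmodule_isNormed.Build F (renormed N) (@norm_triangle F V N)
    (@norm_scale F V N) (@norm_eq0 F V N).

Definition equivalent_norms (F : numFieldType) (V : Type) (N M : V -> F) : Prop :=
  exists c C : F, [/\ 0 < c, 0 < C & forall v, c * M v <= N v <= C * M v].

Section ContinuousFunctions.
Variables (K : topologicalType) (F : numFieldType).

Definition cfun : Type := continuousType K F.

HB.instance Definition _ := Choice.on cfun.

Implicit Types f g : continuousType K F.

Let cts_zero : continuous (fun _ : K => 0 : F).
Proof. by move=> k; exact: cvg_cst. Qed.

Let cts_opp f : continuous (fun k => - f k).
Proof. by move=> k; apply: cvgN; exact: cts_fun. Qed.

Let cts_add f g : continuous (fun k => f k + g k).
Proof. by move=> k; apply: cvgD; exact: cts_fun. Qed.

Let cts_scale (a : F) f : continuous (fun k => a * f k).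
Proof. by move=> k; apply: cvgMr; exact: cts_fun. Qed.

Definition cfun_zero : cfun := mkcts cts_zero.
Definition cfun_opp (f : cfun) : cfun := mkcts (@cts_opp f).
Definition cfun_add (f g : cfun) : cfun := mkcts (@cts_add f g).
Definition cfun_scale (a : F) (f : cfun) : cfun := mkcts (@cts_scale a f).

Let cfun_addA : associative cfun_add.
Proof. by move=> f g h; apply/continuousEP => k /=; exact: addrA. Qed.

Let cfun_addC : commutative cfun_add.
Proof. by move=> f g; apply/continuousEP => k /=; exact: addrC. Qed.

Let cfun_add0 : left_id cfun_zero cfun_add.
Proof. by move=> f; apply/continuousEP => k /=; exact: add0r. Qed.

Let cfun_addN : left_inverse cfun_zero cfun_opp cfun_add.
Proof. by move=> f; apply/continuousEP => k /=; exact: addNr. Qed.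

HB.instance Definition _ :=
  GRing.isZmodule.Build cfun cfun_addA cfun_addC cfun_add0 cfun_addN.

Let cfun_scaleA a b (f : cfun) :
  cfun_scale a (cfun_scale b f) = cfun_scale (a * b) f.
Proof. by apply/continuousEP => k /=; exact: mulrA. Qed.

Let cfun_scale1 : left_id 1 cfun_scale.
Proof. by move=> f; apply/continuousEP => k /=; exact: mul1r. Qed.

Let cfun_scaleDr : right_distributive cfun_scale +%R.
Proof. by move=> a f g; apply/continuousEP => k /=; exact: mulrDr. Qed.

Let cfun_scaleDl (f : cfun) : {morph cfun_scale^~ f : a b / a + b}.
Proof. by move=> a b; apply/continuousEP => k /=; exact: mulrDl. Qed.

HB.instance Definition _ :=
  GRing.Zmodule_isLmodule.Build F cfun cfun_scaleA cfun_scale1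
    cfun_scaleDr cfun_scaleDl.

(* See the remark on suprema in [F] above. *)
Definition sup_norm (f : cfun) : F := supremum 0 (range (fun k => `|f k|)).

End ContinuousFunctions.

Variant scalars := RealScalars | ComplexScalars.

Definition scalar_field (R : realType) (s : scalars) : numFieldType :=
  match s with RealScalars => R | ComplexScalars => R[i] end.

(* Main.v *)
From HB Require Import structures.
Require Import Defs.
From mathcomp Require Import all_boot all_order all_algebra.
From mathcomp Require Import complex.
From mathcomp Require Import all_classical all_reals all_analysis.
From mathcomp Require Import ring zify.

(* Write w for omega^xi and K_i for the Cantor-Bendixson derivative of K of order
   w i. The index of K is less than omega^(xi+1) iff some K_n is empty.

   If K_n is empty, put |f| = sup_k u(k) |f(k)| where u(k) is the number of i
   with k in K_i. Given |y| <= 1 and a small sigma, adding functions bounded by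
   sigma can push u |y| above 1 only on a closed set L with L^w empty, and a
   weakly null tree of order w has convex combinations of its branches that are
   uniformly small on such an L. The latter goes by induction on xi: if
   L^(omega^eta k) is empty, average many successive blocks, each small on the
   derivatives of the sets where the previous ones are large, so that every
   point sees fewer than k large blocks.

   Conversely, if p is in the derivative of L of order w, then following the
   decreasing sequences of ordinals below w one builds a weakly null tree of
   bump functions all of whose branches are bounded below on a common
   neighbourhood of some point of L. If the norm is flat, a convex combination
   of such a branch can be added to y almost without increasing the norm of y.
   Starting from a point of K_n this can be done n times, so the supremum norm
   grows linearly in n while the equivalent norm stays below 2. *)

Set Implicit Arguments.
Unset Strict Implicit.
Unset Printing Implicit Defensive.

Import Order.TTheory GRing.Theory Num.Theory.
Import numFieldNormedType.Exports.

Local Open Scope classical_set_scope.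
Local Open Scope ring_scope.

(** * Ordinals and iterated derivatives *)

Lemma ole_osup (I : Type) (i0 : I) (f : I -> ord) a i :
  ole a (f i) -> ole a (OSup i0 f).
Proof.
elim: a => [|a _|J j0 g IH] //= H; first by exists i.
by move=> j; exact: IH.
Qed.

Lemma ole_refl a : ole a a.
Proof. by elim: a => [|a|I i0 f IH] //= i; exact: ole_osup (IH i). Qed.

Lemma ole_trans a b c : ole a b -> ole b c -> ole a c.
Proof.
elim: a b c => [|a IHa|I i0 f IH] //; last by move=> b c H Hbc i; exact: IH Hbc.
elim=> [|b _|I i0 f IHb] //.
  move=> c Hab; elim: c => [|c _|J j0 g IHc] //=; first exact: IHa.
  by move=> [i Hi]; exists i; exact: IHc.
by move=> c /= [i Hi] H; exact: IHb Hi (H i).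
Qed.

Lemma ole_total a b : ole a b \/ olt b a.
Proof.
elim: a b => [|a IHa|I i0 f IH]; first by left.
  elim=> [|b _|I i0 f IHb]; first by right.
    by case: (IHa b) => H; [left|right].
  have [[i Hi]|H] := pselect (exists i, ole (OSucc a) (f i)).
    by left; exists i.
  by right=> i; case: (IHb i) => // Hi; case: H; exists i.
move=> b; have [[i Hi]|H] := pselect (exists i, olt b (f i)).
  by right; exists i.
by left=> i; case: (IH i b) => // Hi; case: H; exists i.
Qed.

Lemma ole_succ a : ole a (OSucc a).
Proof.
suff H b : ole a b -> ole a (OSucc b) by apply/H/ole_refl.
elim: a b => [|a IHa|I i0 f IH] //; last by move=> b H i; exact: IH.
elim=> [|b _|I i0 f IHb] //=; first exact: IHa.
move=> [i Hi]; have := IHb i Hi. exact: (@ole_osup _ i0 f a i).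
Qed.

Lemma oltW a b : olt a b -> ole a b.
Proof. exact: ole_trans (ole_succ a). Qed.

Lemma olt_ole_trans a b c : olt a b -> ole b c -> olt a c.
Proof. exact: ole_trans. Qed.

Lemma ole_olt_trans a b c : ole a b -> olt b c -> olt a c.
Proof. by move=> H; apply: ole_trans. Qed.

Lemma olt_wf : well_founded olt.
Proof.
suff H a b : olt b a -> Acc olt b by move=> a; constructor => b; exact: H.
elim: a b => [|a IHa|I i0 f IH] b; first by [].
  rewrite /olt /= => ba; constructor=> c cb; apply: IHa.
  exact: (@olt_ole_trans c b a).
by move=> [i bi]; exact: (IH i).
Qed.

Lemma oltxx a : ~ olt a a.
Proof. by elim/(well_founded_ind olt_wf): a => a IH aa; exact: (IH a aa aa). Qed.

Lemma olt_geF a b : olt a b -> ~ ole b a.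
Proof. by move=> ab ba; exact: (@oltxx a (olt_ole_trans ab ba)). Qed.

Lemma oaddA a b c : oadd a (oadd b c) = oadd (oadd a b) c.
Proof.
elim: c => [|c IH|I i0 f IH] //=; first by rewrite IH.
by congr OSup; apply/funext.
Qed.

Lemma ole_oaddr a b c : ole b c -> ole (oadd a b) (oadd a c).
Proof.
have H0 d : ole a (oadd a d).
  elim: d => [|d IH|I i0 f IH] /=; [exact: ole_refl| |exact: (ole_osup i0 (IH i0))].
  exact: ole_trans IH (ole_succ _).
elim: b c => [|b IHb|I i0 f IH] c; first by move=> _; exact: H0.
  by elim: c => [|c _|I i0 f IHc] //=; [exact: IHb|move=> [i Hi]; exists i; exact: IHc].
by move=> H i; exact: IH.
Qed.

Lemma olt_oaddr a b c : olt b c -> olt (oadd a b) (oadd a c).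
Proof. exact: ole_oaddr. Qed.

(** Written so that [omul a omega] is convertible to the supremum of the [omul a (onat n)]. *)
Definition onat (n : nat) : ord := iter n OSucc OZero.

Lemma omulS a n : omul a (onat n.+1) = oadd (omul a (onat n)) a.
Proof. by []. Qed.

Lemma oexp_omega_gt0 a : olt OZero (oexp omega a).
Proof.
elim: a => [|a IH|I i0 f IH] //=; last by exists i0; exact: IH.
by exists 1%N; exact: (olt_oaddr OZero IH).
Qed.

Lemma olt_omulS a n : olt OZero a -> olt (omul a (onat n)) (omul a (onat n.+1)).
Proof. exact: (@olt_oaddr (omul a (onat n))). Qed.

Lemma oadd0 a : oadd OZero a = a.
Proof.
elim: a => [|a IH|I i0 f IH] //=; first by rewrite IH.
by congr OSup; apply/funext.
Qed.

Lemma ole_omul_onat a m n : (m <= n)%N ->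
  ole (omul a (onat m)) (omul a (onat n)).
Proof.
move=> mn; rewrite -(subnKC mn); elim: (n - m)%N => [|k IH].
  by rewrite addn0; exact: ole_refl.
rewrite addnS; apply: ole_trans IH _; exact: (@ole_oaddr (omul a (onat _)) OZero).
Qed.

Section Derivative.
Variables (U : Type) (d : set U -> set U).
Hypothesis d_sub : forall A, d A `<=` A.
Hypothesis d_mono : forall A B, A `<=` B -> d A `<=` d B.

Lemma derivative_sub A a : derivative d A a `<=` A.
Proof.
elim: a => [|a IH|I i0 f IH] //=; first exact: subset_trans (@d_sub _) IH.
by move=> u /(_ i0 Logic.I); exact: IH.
Qed.

Lemma derivative_mono A B a : A `<=` B -> derivative d A a `<=` derivative d B a.
Proof.
move=> AB; elim: a => [|a IH|I i0 f IH] //=; first exact: d_mono.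
by move=> u H i _; apply: IH; exact: H.
Qed.

Lemma derivative_anti A a b : ole a b -> derivative d A b `<=` derivative d A a.
Proof.
elim: a b => [|a IHa|I i0 f IH] b; first by move=> _; exact: derivative_sub.
  elim: b => [|b _|I i0 f IHb] //=; first by move=> ab; apply/d_mono/IHa.
  by move=> [i Hi] u /(_ i Logic.I); exact: IHb.
by move=> H u ub i _; exact: IH (H i) _ ub.
Qed.

Lemma derivative_oadd A a b :
  derivative d A (oadd a b) = derivative d (derivative d A a) b.
Proof.
elim: b => [|b IH|I i0 f IH] //=; first by rewrite IH.
by apply: eq_bigcapr => i _.
Qed.

Lemma vanishes_first_ex A a : derivative d A a = set0 ->
  exists b, vanishes_first d A b /\ ole b a.
Proof.
elim/(well_founded_ind olt_wf): a => a IH Aa.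
have [[b [ba Ab]]|H] := pselect (exists b, olt b a /\ derivative d A b = set0).
  by have [c [? cb]] := IH b ba Ab; exists c; split=> //; exact: ole_trans cb (oltW ba).
by exists a; split; [split=> // b ba Ab; apply: H; exists b|exact: ole_refl].
Qed.

End Derivative.

(** * Cantor-Bendixson derivatives *)

Section CantorBendixson.
Variable K : topologicalType.
Implicit Types (L M : set K) (p : K).
Local Notation CB := (@CB_derivative K).
Local Notation CBd := (derivative CB).

Lemma CB_derivativeP L p :
  CB L p <-> L p /\ forall V, nbhs p V -> exists q, [/\ V q, L q & q <> p].
Proof.
split=> [[Lp nip]|[Lp H]].
  split=> // V pV; apply: contrapT => nq; apply: nip; split; first exact/mem_set.
  exists V => //; apply/seteqP; split=> [q [Vq Lq]|_ ->] /=.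
    by apply: contrapT => qp; apply: nq; exists q.
  by split=> //; exact: nbhs_singleton.
split=> // -[_ [V pV VL]]; have [q [Vq Lq qp]] := H V pV.
by apply: qp; have : (V `&` L) q by []; rewrite VL.
Qed.

Lemma CB_derivative_sub L : CB L `<=` L.
Proof. by move=> p []. Qed.

Lemma CB_derivative_mono L M : L `<=` M -> CB L `<=` CB M.
Proof.
move=> LM p /CB_derivativeP [Lp H]; apply/CB_derivativeP; split; first exact: LM.
by move=> V /H [q [Vq Lq qp]]; exists q; split=> //; exact: LM.
Qed.

Lemma CB_derivative_closed L : closed L -> closed (CB L).
Proof.
move=> cL p clp; apply/CB_derivativeP; split.
  by apply: cL => V /clp [q [[Lq _] Vq]]; exists q.
move=> V; rewrite nbhsE /= => -[W [oW Wp] WV].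
have [q [qL Wq]] := clp W (open_nbhs_nbhs (conj oW Wp)).
have /CB_derivativeP [Lq Hq] := qL.
have [qp|qp] := pselect (q = p); last by exists q; split=> //; exact: WV.
have [r [Wr Lr rq]] := Hq W (open_nbhs_nbhs (conj oW Wq)).
by exists r; split=> //; [exact: WV|rewrite -qp].
Qed.

(** A point outside both derivatives has, for each closed set, a neighbourhood meeting that set at
    most in the point itself; intersect the two. *)
Lemma CB_derivative_setU L M : closed L -> closed M ->
  CB (L `|` M) `<=` CB L `|` CB M.
Proof.
move=> cL cM p /CB_derivativeP [LMp H]; apply: contrapT => /not_orP [nL nM].
have away N : closed N -> ~ CB N p ->
    exists2 V, nbhs p V & forall q, V q -> N q -> q = p.
  move=> cN nN; have [Np|nNp] := pselect (N p); last first.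
    exists (~` N) => //; apply: open_nbhs_nbhs; split=> //.
    exact: closed_openC.
  apply: contrapT => nV; apply/nN/CB_derivativeP; split=> // V pV.
  apply: contrapT => nq; apply: nV; exists V => // q Vq Nq.
  by apply: contrapT => qp; apply: nq; exists q.
have [V pV VL] := away L cL nL; have [W pW WM] := away M cM nM.
have [q [[Vq Wq] [Lq|Mq] qp]] := H _ (filterI pV pW); apply: qp.
  exact: VL.
exact: WM.
Qed.

Lemma derivative_closed L a : closed L -> closed (CBd L a).
Proof.
move=> cL; elim: a => [|a IH|I i0 f IH] //=; first exact: CB_derivative_closed.
by apply: closed_bigI => i _; exact: IH.
Qed.

Lemma derivative_setU L M a : closed L -> closed M ->
  CBd (L `|` M) a `<=` CBd L a `|` CBd M a.
Proof.
move=> cL cM; elim: a => [|a IH|I i0 f IH] //=.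
  apply: subset_trans (CB_derivative_mono IH) _.
  by apply: CB_derivative_setU; exact: derivative_closed.
have out N p : ~ (\bigcap_i CBd N (f i)) p -> exists i, ~ CBd N (f i) p.
  by move=> nN; apply: contrapT => /forallNP ni; apply: nN => i _;
     apply: contrapT; exact: ni.
move=> p H; apply: contrapT => /not_orP [/out [i Li] /out [j Mj]].
have anti N := derivative_anti CB_derivative_sub CB_derivative_mono (A := N).
(* At a supremum the point is lost by [L] at stage [i] and by [M] at stage [j]; at the larger stage
   it is lost by both. *)
case: (ole_total (f i) (f j)) => [|/oltW] le.
  by case: (IH j p (H j Logic.I)) => // Lj; apply: Li; exact: anti le _ Lj.
by case: (IH i p (H i Logic.I)) => // Mi; apply: Mj; exact: anti le _ Mi.
Qed.

Lemma derivative_setU_eq0 L M a : closed L -> closed M ->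
  CBd L a = set0 -> CBd M a = set0 -> CBd (L `|` M) a = set0.
Proof.
move=> cL cM L0 M0; rewrite -subset0 => p /(derivative_setU cL cM).
by rewrite L0 M0 => -[].
Qed.

Hypothesis K_compact : compact [set: K].

(** The derivatives are closed and totally ordered by inclusion; if all were non-empty, compactness
    would give them a common point. *)
Lemma derivative_osup_eq0 L (I : Type) (i0 : I) (f : I -> ord) : closed L ->
  CBd L (OSup i0 f) = set0 -> exists i, CBd L (f i) = set0.
Proof.
move=> cL L0; apply: contrapT => /forallNP ne.
have anti := derivative_anti CB_derivative_sub CB_derivative_mono (A := L).
pose G := filter_from [set: I] (fun i => CBd L (f i)).
have GP : ProperFilter G.
  apply: filter_from_proper; last by move=> i _; apply/set0P/eqP.
  apply: filter_from_filter; first by exists i0.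
  move=> i j _ _; case: (ole_total (f i) (f j)) => [|/oltW] le.
    by exists j => // p Lp; split=> //; exact: anti le _ Lp.
  by exists i => // p Lp; split=> //; exact: anti le _ Lp.
have [p [_ clp]] := K_compact GP filterT.
suff : CBd L (OSup i0 f) p by rewrite L0.
move=> i _; have cLi := @derivative_closed L (f i) cL; apply: cLi => V pV.
by apply: clp => //; exists i.
Qed.

End CantorBendixson.

(** * Suprema and infima of sets of real scalars *)

Section Suprema.
(** Real and complex scalars are treated together: [e] embeds the reals in [F] and its range
    contains every element comparable with 0. *)
Variables (R : realType) (F : numFieldType) (e : {rmorphism R -> F}).
Hypothesis e_le : {mono e : a b / a <= b}.
Hypothesis e_real : forall z : F, z \is Num.real -> exists a, z = e a.

Lemma real_arch (z : F) : z \is Num.real -> exists n : nat, z <= n%:R.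
Proof.
move=> /e_real [a ->]; exists (Num.bound `|a|).
rewrite -(rmorph_nat e) e_le; exact/ltW/(le_lt_trans (ler_norm a))/archi_boundP/normr_ge0.
Qed.

Lemma supremums_ex (S : set F) (M : F) : S !=set0 -> (forall z, S z -> z \is Num.real) ->
  ubound S M -> supremums S !=set0.
Proof.
move=> [z0 Sz0] Sr SM.
have [m Mm] : exists m, M = e m.
  by apply/e_real; rewrite -(ler_real (SM _ Sz0)); exact: Sr.
pose A := e @^-1` S.
have Asup : has_sup A.
  split; first by have [a za] := e_real (Sr _ Sz0); exists a; rewrite /A /= -za.
  by exists m => a /SM; rewrite Mm e_le.
exists (e (sup A)); split.
  move=> z Sz; have [a za] := e_real (Sr _ Sz); rewrite za e_le.
  by apply: sup_upper_bound => //; rewrite /A /= -za.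
move=> b Sb; have [c bc] : exists c, b = e c.
  by apply/e_real; rewrite -(ler_real (Sb _ Sz0)); exact: Sr.
rewrite bc e_le; apply: sup_le_ub; first by case: Asup.
by move=> a /Sb; rewrite bc e_le.
Qed.

Lemma supremum_supremums (S : set F) (M : F) : S !=set0 ->
  (forall z, S z -> z \is Num.real) ->
  ubound S M -> supremums S (supremum 0 S).
Proof.
move=> S0 Sr SM; have [s Ss] := supremums_ex S0 Sr SM.
rewrite /supremum; case: ifPn => [/eqP S00|_].
  by case: S0 => x; rewrite S00.
by case: xgetP => [_ _ //|/(_ s)].
Qed.

Lemma supremum_ubound (S : set F) (M z : F) :
  (forall z, S z -> z \is Num.real) -> ubound S M ->
  S z -> z <= supremum 0 S.
Proof.
by move=> Sr SM Sz; have [|+ _] := supremum_supremums _ Sr SM; [exists z|exact].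
Qed.

Lemma supremum_le (S : set F) (M : F) : S !=set0 -> (forall z, S z -> z \is Num.real) ->
  ubound S M -> supremum 0 S <= M.
Proof. by move=> S0 Sr SM; have [_] := supremum_supremums S0 Sr SM; exact. Qed.

Lemma infimums_ex (S : set F) (M : F) : S !=set0 -> (forall z, S z -> z \is Num.real) ->
  lbound S M -> infimums S !=set0.
Proof.
move=> [z Sz] Sr SM; have [|||s [ubs lbs]] := @supremums_ex (-%R @` S) (- M).
- by exists (- z), z.
- by move=> _ [y Sy <-]; rewrite realN; exact: Sr.
- by move=> _ [y Sy <-]; rewrite lerN2; exact: SM.
exists (- s); split=> [y Sy|y yS]; first by rewrite lerNl; apply: ubs; exists y.
by rewrite lerNr; apply: lbs => _ [w Sw <-]; rewrite lerN2; exact: yS.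
Qed.

Lemma infimum_infimums (S : set F) (M : F) : S !=set0 ->
  (forall z, S z -> z \is Num.real) ->
  lbound S M -> infimums S (infimum 0 S).
Proof.
move=> S0 Sr SM; have [s Ss] := infimums_ex S0 Sr SM.
rewrite /infimum; case: ifPn => [/eqP S00|_].
  by case: S0 => x; rewrite S00.
by case: xgetP => [_ _ //|/(_ s)].
Qed.

Lemma infimum_lbound (S : set F) (M z : F) :
  (forall z, S z -> z \is Num.real) -> lbound S M ->
  S z -> infimum 0 S <= z.
Proof.
by move=> Sr SM Sz; have [|+ _] := infimum_infimums _ Sr SM; [exists z|exact].
Qed.

Lemma infimum_real (S : set F) (M : F) : S !=set0 -> (forall z, S z -> z \is Num.real) ->
  lbound S M -> infimum 0 S \is Num.real.
Proof.
move=> [z Sz] Sr SM; rewrite (ler_real (infimum_lbound Sr SM Sz)).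
exact: Sr.
Qed.

Lemma infimum_lt_ex (S : set F) (M b : F) : S !=set0 ->
  (forall z, S z -> z \is Num.real) ->
  lbound S M -> infimum 0 S < b -> exists2 z, S z & z < b.
Proof.
move=> S0 Sr SM ib; apply: contrapT => H.
have [_ lbi] := infimum_infimums S0 Sr SM.
have br : b \is Num.real by rewrite -(ler_real (ltW ib)) (infimum_real S0 Sr SM).
suff : b <= infimum 0 S by move/(lt_le_trans ib); rewrite ltxx.
apply: lbi => z Sz; have := real_leVge br (Sr _ Sz); case/orP => //.
rewrite [z <= b]le_eqVlt => /orP [/eqP -> //|zb]; exfalso; apply: H.
by exists z.
Qed.

End Suprema.

Lemma supremum_max (F : numFieldType) (S : set F) (m : F) : S m -> ubound S m ->
  supremum 0 S = m.
Proof.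
move=> Sm ubm; have supm : supremums S m by split=> // b; exact.
rewrite /supremum; case: ifPn => [/eqP S0|_]; first by move: Sm; rewrite S0.
by case: xgetP => [s _ sups|/(_ m)//]; exact: (is_subset1_supremums sups supm).
Qed.

Lemma infimum_set1 (F : numFieldType) (x : F) : infimum 0 [set x] = x.
Proof.
rewrite /infimum ifF; last by apply/negbTE/set0P; exists x.
by rewrite infimums1; case: xgetP => [y _ ->//|/(_ x)/(_ erefl)].
Qed.

(** * Weighted sums and trees *)

Section WeightedSums.
Variables (F : numFieldType) (V : lmodType F).
Implicit Types (A B : set V) (u v : V) (c d : F).

(* [convex_hull A] is convertible to [weighted_sums 1 A]. *)
Definition weighted_sums c A : set V :=
  [set v | exists n (w : 'I_n -> F) (a : 'I_n -> V),
    [/\ forall i, 0 <= w i, \sum_(i < n) w i = c, forall i, A (a i)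
      & v = \sum_(i < n) w i *: a i]].

Lemma weighted_sums0 A : weighted_sums 0 A 0.
Proof.
by exists 0%N, (fun=> 0), (fun=> 0); split=> //; rewrite ?big_ord0// => -[].
Qed.

Lemma weighted_sums1 A v : A v -> weighted_sums 1 A v.
Proof.
move=> Av; exists 1%N, (fun=> 1), (fun=> v); split=> //; rewrite big_ord1//.
by rewrite scale1r.
Qed.

Lemma weighted_sumsD c d A u v : weighted_sums c A u -> weighted_sums d A v ->
  weighted_sums (c + d) A (u + v).
Proof.
move=> [n [w [a [w0 wc Aa ->]]]] [m [w' [a' [w'0 wd Aa' ->]]]].
exists (n + m)%N, (fun i => match fintype.split i with inl i => w i | inr i => w' i end),
  (fun i => match fintype.split i with inl i => a i | inr i => a' i end).
split=> [i||i|]; [by case: (fintype.split i)| |by case: (fintype.split i)|].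
  rewrite big_split_ord/= -wc -wd; congr (_ + _); apply: eq_bigr => i _.
    by rewrite (unsplitK (inl i)).
  by rewrite (unsplitK (inr i)).
rewrite big_split_ord/=; congr (_ + _); apply: eq_bigr => i _.
  by rewrite (unsplitK (inl i)).
by rewrite (unsplitK (inr i)).
Qed.

Lemma weighted_sumsZ b c A v : 0 <= b -> weighted_sums c A v ->
  weighted_sums (b * c) A (b *: v).
Proof.
move=> b0 [n [w [a [w0 wc Aa ->]]]]; exists n, (fun i => b * w i), a.
split=> // [i||]; [exact: mulr_ge0|by rewrite -mulr_sumr wc|].
by rewrite scaler_sumr; apply: eq_bigr => i _; rewrite scalerA.
Qed.

Lemma weighted_sums_mono c A B v : A `<=` B -> weighted_sums c A v ->
  weighted_sums c B v.
Proof.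
by move=> AB [n [w [a [w0 wc Aa ->]]]]; exists n, w, a; split=> // i; exact: AB.
Qed.

End WeightedSums.

Section ContinuousFunctionValues.
Variables (K : topologicalType) (F : numFieldType).
Implicit Types f g : cfun K F.

Lemma cfunDE f g k : (f + g) k = f k + g k. Proof. by []. Qed.

Lemma cfunZE (a : F) f k : (a *: f) k = a * f k. Proof. by []. Qed.

Lemma cfun_sumE (I : Type) (r : seq I) (f : I -> cfun K F) k :
  (\sum_(i <- r) f i) k = \sum_(i <- r) f i k.
Proof. by elim/big_rec2: _ => // i y1 y2 _ <-. Qed.

(** The inequality is negated because the order of [F] is partial; the set is then the complement of
    an open one for every [c]. *)
Lemma closed_norm_ge f (c : F) : closed [set k | ~~ (`|f k| < c)].
Proof.
rewrite -openC openE => k /= /negP; rewrite negbK => kc.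
have /cvgr_dist_lt : f @ k --> f k by exact: cts_fun.
move=> /(_ (c - `|f k|)); rewrite subr_gt0 => /(_ kc); apply: filterS => q.
rewrite distrC ltrBrDl => H; apply/negP; rewrite negbK; apply: le_lt_trans H.
by rewrite -{1}(subrK (f k) (f q)) addrC ler_normD.
Qed.

Lemma weighted_sums_le (c m : F) (A : set (cfun K F)) v k :
  (forall a, A a -> `|a k| <= m) -> weighted_sums c A v -> `|v k| <= c * m.
Proof.
move=> Am [n [w [a [w0 <- Aa ->]]]]; rewrite cfun_sumE mulr_suml.
apply: le_trans (ler_norm_sum _ _ _) _; apply: ler_sum => i _.
by rewrite cfunZE normrM ger0_norm// ler_wpM2l// Am.
Qed.

Lemma weighted_sums_ge (c m : F) (A : set (cfun K F)) v k :
  (forall a, A a -> m <= a k) -> weighted_sums c A v -> c * m <= v k.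
Proof.
move=> Am [n [w [a [w0 <- Aa ->]]]]; rewrite cfun_sumE mulr_suml.
by apply: ler_sum => i _; rewrite cfunZE ler_wpM2l// Am.
Qed.

End ContinuousFunctionValues.

Section Trees.
Variable Lambda : Type.
Implicit Types (T : set (seq Lambda)) (s t : seq Lambda).

Lemma initial_segment_refl (S : Type) (s : seq S) : initial_segment s s.
Proof. by exists [::]; rewrite cats0. Qed.

Lemma initial_segment_trans (S : Type) (s t u : seq S) :
  initial_segment s t -> initial_segment t u -> initial_segment s u.
Proof. by move=> [a ->] [b ->]; exists (a ++ b); rewrite catA. Qed.

Lemma initial_segment_rcons (S : Type) (s : seq S) z :
  initial_segment s (rcons s z).
Proof. by exists [:: z]; rewrite cats1. Qed.

Lemma initial_segment_antisym (S : Type) (s t : seq S) :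
  initial_segment s t -> initial_segment t s -> s = t.
Proof.
move=> [[|a u] ->]; first by rewrite cats0.
by move=> [v /(congr1 size)]; rewrite !size_cat /=; lia.
Qed.

Definition tree_derivative T := T `\` MAX T.

Lemma tree_derivative_sub T : tree_derivative T `<=` T.
Proof. by move=> t []. Qed.

Lemma tree_derivativeP T t : tree_derivative T t <->
  T t /\ exists s, [/\ T s, initial_segment t s & s <> t].
Proof.
split=> [[Tt nM]|[Tt [s [Ts ts nst]]]].
  split=> //; apply: contrapT => /forallNP H; apply: nM; split=> // s Ts ts.
  by apply: contrapT => nst; exact: (H s).
by split=> // -[_ /(_ s Ts ts)].
Qed.

Lemma tree_derivative_mono S T : S `<=` T ->
  tree_derivative S `<=` tree_derivative T.
Proof.
move=> ST t /tree_derivativeP [St [s [Ss ts nst]]]; apply/tree_derivativeP.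
by split; [exact: ST|exists s; split=> //; exact: ST].
Qed.

Lemma derivative_tree T a : is_tree T -> is_tree (derivative tree_derivative T a).
Proof.
move=> treeT; split.
  move=> t /(derivative_sub tree_derivative_sub); exact: (proj1 treeT).
elim: a => [|a IH|I i0 f IH] /=; first exact: (proj2 treeT).
  move=> s t /tree_derivativeP [Tt [r [Tr tr nrt]]] s0 st; apply/tree_derivativeP.
  split; first exact: IH st.
  exists r; split=> //; first exact: initial_segment_trans st tr.
  by move=> rs; apply: nrt; apply: initial_segment_antisym tr; rewrite rs.
by move=> s t Ht s0 st i _; exact: (IH i s t (Ht i Logic.I)).
Qed.

(** A surviving proper extension of [t] has an initial segment one longer than [t], which survives
    because derivatives of trees are trees. *)
Lemma tree_child T a t : is_tree T ->
  derivative tree_derivative T (OSucc a) t ->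
  exists z, derivative tree_derivative T a (rcons t z).
Proof.
move=> treeT /tree_derivativeP [Tt [s [Ts [[|z u] stu] nst]]].
  by case: nst; rewrite stu cats0.
exists z; apply: (proj2 (derivative_tree a treeT)) Ts _ _; first by case: (t).
by exists u; rewrite stu cat_rcons.
Qed.

End Trees.

Instance tails_proper (D : directed_set) : ProperFilter (tails D).
Proof.
apply: filter_from_proper; last by move=> u _; exists u; exact: dle_refl.
apply: filter_from_filter; first by case: (dinhabited D) => u; exists u.
move=> u v _ _; have [w [uw vw]] := dle_directed u v; exists w => // z wz.
by split; [exact: dle_trans uw wz|exact: dle_trans vw wz].
Qed.

(** * Small convex combinations on sets of small rank *)

Section SmallCombinations.
Variables (F : numFieldType) (K : topologicalType).
Hypothesis F_arch : forall z : F, z \is Num.real -> exists n : nat, z <= n%:R.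
Hypothesis K_compact : compact [set: K].
Variables (Lambda : Type) (T : set (seq Lambda)) (D : directed_set).
Variables (x : seq (Lambda * D) -> cfun K F) (sigma : F).
Hypothesis T_tree : is_tree T.
Hypothesis sigma_ge0 : 0 <= sigma.
Hypothesis x_le : forall t, tree_dir T D t -> forall k, `|x t k| <= sigma.
Hypothesis x_null : forall t, tree_dir T D t \/ t = [::] ->
  forall z, (forall u, tree_dir T D (rcons t (z, u))) ->
  forall k, (fun u => x (rcons t (z, u)) k : F^o) @ tails D --> (0 : F^o).

Local Notation CBd := (derivative (@CB_derivative K)).
Local Notation Td := (derivative (@tree_derivative Lambda) T).
Local Notation node t := (tree_dir T D t \/ t = [::]).

(** The nodes after [t] up to and including [t']; blocks over consecutive intervals lie on one
    branch. *)
Definition between (t t' : seq (Lambda * D)) : set (seq (Lambda * D)) :=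
  [set s | [/\ initial_segment t s, s <> t & initial_segment s t']].

(** This follows from survival of [oadd c a] derivations, but is phrased through children to cover
    the empty sequence, which is no member of the tree. *)
Definition has_children_at (t : seq (Lambda * D)) (c a : ord) : Prop :=
  forall b, olt b a -> exists z, Td (oadd c b) (rcons (unzip1 t) z).

Lemma unzip1_rcons (t : seq (Lambda * D)) z u :
  unzip1 (rcons t (z, u)) = rcons (unzip1 t) z.
Proof. by rewrite /unzip1 map_rcons. Qed.

Lemma Td_sub a t : Td a t -> T t.
Proof. exact: (derivative_sub (@tree_derivative_sub Lambda)). Qed.

Lemma Td_anti a b t : ole a b -> Td b t -> Td a t.
Proof.
move=> ab; apply: (derivative_anti _ _ ab).
  exact: tree_derivative_sub.
exact: tree_derivative_mono.
Qed.

Lemma Td_children t c a : Td (oadd c a) (unzip1 t) -> has_children_at t c a.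
Proof.
by move=> Tt b ba; apply: (tree_child T_tree); exact: (Td_anti (ole_oaddr c ba) Tt).
Qed.

Lemma betweenS s t r t' : initial_segment s t -> initial_segment r t' ->
  between t r `<=` between s t'.
Proof.
move=> st rt q [tq nqt qr]; split.
- exact: initial_segment_trans st tq.
- by move=> qs; apply: nqt; apply: initial_segment_antisym tq; rewrite qs.
- exact: initial_segment_trans qr rt.
Qed.

Lemma between_node t s : T (unzip1 s) -> between [::] s t -> tree_dir T D t.
Proof.
move=> Ts [_ nt [u su]]; apply: (proj2 T_tree) Ts _ _.
  by case: t nt {su} => // a t nt.
by exists (unzip1 u); rewrite su /unzip1 map_cat.
Qed.

Lemma between_nil t t' : between t t' `<=` between [::] t'.
Proof. by apply: betweenS; [exists t|exact: initial_segment_refl]. Qed.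

Lemma between_weighted_le t t' c v k : T (unzip1 t') ->
  weighted_sums c (x @` between t t') v -> `|v k| <= c * sigma.
Proof.
move=> Tt'; apply: weighted_sums_le => _ [s /between_nil st' <-].
by apply: x_le; exact: between_node st'.
Qed.

(** The end node [t'] survives [c] derivations, which leaves room for later blocks on the same
    branch. *)
Definition small_combination (L : set K) (c : ord) t (eps : F) : Prop :=
  exists t' v, [/\ Td c (unzip1 t'), initial_segment t t',
    weighted_sums 1 (x @` between t t') v & forall k, L k -> `|v k| <= eps].

(** A compact set whose points are all isolated is finite, so pointwise convergence along the net is
    uniform on it. *)
Lemma near_small_isolated L t z eps : closed L -> @CB_derivative K L = set0 ->
  node t -> (forall u, tree_dir T D (rcons t (z, u))) -> 0 < eps ->
  exists u, forall k, L k -> `|x (rcons t (z, u)) k| <= eps.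
Proof.
move=> cL L0 nt nz eps0.
have /compact_near_coveringP/near_covering_withinP cvL : compact L.
  exact: subclosed_compact cL K_compact _.
have [] // := @filter_ex _ (tails D) _
  (fun u => L `<=` (fun k => `|x (rcons t (z, u)) k| <= eps)).
  apply: (cvL D (tails D) (fun u k => `|x (rcons t (z, u)) k| <= eps)) => k Lk.
  have [_ [V kV VL]] : isolated L k.
    by apply: contrapT => nk; have : CB_derivative L k by []; rewrite L0.
  exists (V, [set u | `|x (rcons t (z, u)) k| <= eps]) => /=.
    split=> //; have /cvgr0Pnorm_le := x_null nt nz k.
    exact.
  move=> [q u] [/= Vq ku] Lq; suff -> : q = k by [].
  by have : (V `&` L) q by []; rewrite VL.
by move=> u Hu; exists u.
Qed.

Lemma closed_finite_union (C : nat -> set K) a n :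
  (forall r, (r < n)%N -> closed (C r) /\ CBd (C r) a = set0) ->
  exists M, [/\ closed M, CBd M a = set0 &
    forall r, (r < n)%N -> C r `<=` M].
Proof.
elim: n => [|n IH] H.
  exists set0; split=> //; first exact: closed0.
  by rewrite -subset0; exact: (derivative_sub (@CB_derivative_sub K)).
have [r rn|M [cM M0 CM]] := IH; first by apply: H; exact: ltnW.
have [cC C0] := H n (ltnSn n).
exists (M `|` C n); split; first exact: closedU.
  exact: derivative_setU_eq0.
move=> r; rewrite ltnS leq_eqVlt => /orP [/eqP ->|rn]; first by right.
by move=> k Ck; left; exact: CM Ck.
Qed.

(* [B r] contains the points of [L] at which at least [r] of the blocks summed
   in [v] are larger than [e]; its rank decreases with [r]. *)
Definition block_state (L : set K) (w : ord) (kappa : nat) (e : F) t j t' v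
    (B : nat -> set K) : Prop :=
  [/\ initial_segment t t', weighted_sums j%:R (x @` between t t') v,
      B 0%N = L,
      forall r, closed (B r) /\
        ((r <= kappa)%N -> CBd (B r) (omul w (onat (kappa - r))) = set0)
    & forall k r, L k -> ~ B r.+1 k -> `|v k| <= j%:R * e + r%:R * sigma].

(** The new block is small on the union [M] of the [C r], so the set [A] where it is large misses
    [M]. Hence the part of [B r] in [A] loses one multiple of [w] in rank. *)
Lemma small_combination_block L w kappa e t j t' v B c :
  (forall M d s eps, closed M -> CBd M w = set0 -> node s ->
     has_children_at s d w -> 0 < eps -> small_combination M d s eps) ->
  0 < e -> block_state L w kappa e t j t' v B -> node t' ->
  has_children_at t' c w ->
  exists t'' v' B', block_state L w kappa e t j.+1 t'' v' B' /\
    Td c (unzip1 t'').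
Proof.
move=> IH e0 [tt' sv B0 Bcl vB] nt' ch.
pose C r := CBd (B r) (omul w (onat (kappa - r.+1))).
have [r rk|M [cM M0 CM]] := @closed_finite_union C w kappa.
  have [cB Br0] := Bcl r; split; first exact: derivative_closed.
  rewrite /C -derivative_oadd -omulS subnSK//; apply: Br0.
  exact: ltnW.
(* The tolerance [e / 2] keeps [z] strictly below [e] on [M], so that [A] and [M] are disjoint. *)
have [t'' [z [Tt'' t't'' sz zM]]] :=
  IH M c t' (e / 2) cM M0 nt' ch (divr_gt0 e0 (ltr0Sn F 1)).
pose A := [set k | ~~ (`|z k| < e)].
have cA : closed A by exact: closed_norm_ge.
have MA k : M k -> ~ A k.
  move=> Mk; apply/negP; rewrite negbK; apply: le_lt_trans (zM k Mk) _.
  by rewrite ltr_pdivrMr// ltr_pMr// ltr1n.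
exists t'', (v + z),
  (fun r => if r is r'.+1 then B r'.+1 `|` (B r' `&` A) else L).
split=> //; split=> //.
- exact: initial_segment_trans tt' t't''.
- rewrite -addn1 natrD; apply: weighted_sumsD.
    apply: weighted_sums_mono sv; apply: image_subset.
    by apply: betweenS => //; exact: initial_segment_refl.
  apply: weighted_sums_mono sz; apply: image_subset.
  by apply: betweenS => //; exact: initial_segment_refl.
- move=> [|r]; first by rewrite -B0; exact: Bcl.
  have cBA : closed (B r `&` A) by apply: closedI => //; exact: (proj1 (Bcl r)).
  have [cB Br0] := Bcl r.+1.
  split; first exact: closedU.
  move=> rk; apply: derivative_setU_eq0 => //; first exact: Br0.
  rewrite -subset0 => k kBA.
  have BAk := derivative_sub (@CB_derivative_sub K) kBA.
  apply: (MA k) (proj2 BAk); apply: (CM r rk).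
  by apply: derivative_mono kBA; [exact: CB_derivative_mono|move=> q []].
- move=> k r Lk /not_orP [nB nBA].
  have zs : `|z k| <= sigma.
    by rewrite -[sigma]mul1r; apply: between_weighted_le sz; exact: Td_sub Tt''.
  apply: le_trans (ler_normD _ _) _.
  (* A block small at [k] adds at most [e]. A block large at [k] adds at most [sigma], but then [k]
     is outside [B r], so the earlier bound holds with one [sigma] less. *)
  have [ze|ze] := boolP (`|z k| < e).
    rewrite -addn1 natrD mulrDl mul1r addrAC lerD//; [exact: vB|exact: ltW].
  case: r nB nBA => [|r] nB nBA; first by case: nBA; rewrite B0.
  have {}nBA : ~ B r.+1 k by move=> Bk; apply: nBA.
  rewrite -[r.+1]addn1 natrD mulrDl mul1r addrA lerD//.
  apply: le_trans (vB k r Lk nBA) _; by rewrite lerD2r ler_wpM2r ?ler_nat// ltW.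
Qed.

(** Compactness replaces the rank at a successor by a finite multiple [omul w (onat kappa)], and the
    rank at a supremum by a member of the family. *)
Lemma small_combination_exp eta L c t eps : closed L ->
  CBd L (oexp omega eta) = set0 -> node t ->
  has_children_at t c (oexp omega eta) -> 0 < eps ->
  small_combination L c t eps.
Proof.
elim: eta L c t eps => [|eta IH|I i0 f IH] L c t eps cL L0 nt ch eps0.
- have [//|z Tz] := ch OZero.
  have [|u Hu] := near_small_isolated (z := z) cL L0 nt _ eps0.
    by move=> u; rewrite /tree_dir /= unzip1_rcons; exact: Td_sub Tz.
  exists (rcons t (z, u)), (x (rcons t (z, u))); split=> //.
  + by rewrite unzip1_rcons.
  + exact: initial_segment_rcons.
  + apply: weighted_sums1; exists (rcons t (z, u)) => //; split.
    * exact: initial_segment_rcons.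
    * by move=> /(congr1 size); rewrite size_rcons; lia.
    * exact: initial_segment_refl.
- set w := oexp omega eta.
  have [kappa Lk] := derivative_osup_eq0 K_compact cL L0.
  have e0 : 0 < eps / 2 by rewrite divr_gt0.
  (* In the average of [m.+1] blocks the fewer than [kappa] large ones contribute at most [eps / 2],
     and the small ones at most the other half. *)
  have [m Hm] : exists m : nat, kappa%:R * sigma / (eps / 2) <= m%:R.
    apply: F_arch; by rewrite ger0_real// divr_ge0//; [exact: mulr_ge0|exact: ltW].
  (* Stage [j] reserves [m.+1 - j] multiples of [w] for the remaining blocks. Survival of the node
     itself is claimed for [0 < j] only, since [t] may be the empty sequence. *)
  have step j : (j <= m.+1)%N -> exists t' v B,
      [/\ block_state L w kappa (eps / 2) t j t' v B, node t',
          has_children_at t' c (omul w (onat (m.+1 - j))) &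
          (0 < j)%N -> Td (oadd c (omul w (onat (m.+1 - j)))) (unzip1 t')].
    elim: j => [|j IHj] jm.
      exists t, 0, (fun r => if r is 0%N then L else set0); split=> //.
        split=> //; first exact: initial_segment_refl.
        + exact: weighted_sums0.
        + move=> [|r]; first by rewrite subn0.
          split=> [|_]; first exact: closed0.
          rewrite -subset0; exact: (derivative_sub (@CB_derivative_sub K)).
        + by move=> k r _ _; rewrite normr0 addr_ge0// mulr_ge0// ltW.
      rewrite subn0 => b bm; apply: ch; exact: (@ole_osup _ 0%N _ _ m.+1).
    have [t' [v [B [st nt' ch' _]]]] := IHj (ltnW jm).
    have jm' : (m.+1 - j = (m.+1 - j.+1).+1)%N by lia.
    have [|t'' [v' [B' [st' Tt'']]]] := small_combination_block (t' := t')
        (c := oadd c (omul w (onat (m.+1 - j.+1)))) IH e0 st nt'.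
      move=> b bw; rewrite -oaddA; apply: ch'; rewrite jm' omulS.
      exact: olt_oaddr.
    exists t'', v', B'; split=> //; first by left; exact: Td_sub Tt''.
    exact: Td_children.
  have [t' [v [B [[tt' sv B0 Bcl vB] _ _ Tt']]]] := step m.+1 (leqnn _).
  exists t', (m.+1%:R^-1 *: v); split=> //.
  + by move: Tt'; rewrite subnn; exact.
  + have m0 : 0 <= m.+1%:R^-1 :> F by rewrite invr_ge0.
    by have := weighted_sumsZ m0 sv; rewrite mulVf ?pnatr_eq0.
  (* For [kappa] equal to 0 the set [L] is empty. Otherwise [B kappa] has rank 0, so it is empty and
     fewer than [kappa] blocks are large at [k]. *)
  + move=> k Lkk; case: kappa => [|kappa] in Lk Hm Bcl vB step *.
      by have : CBd L (omul w (onat 0)) k by []; rewrite Lk.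
    have nB : ~ B kappa.+1 k.
      have [_ /(_ (leqnn _))] := Bcl kappa.+1; rewrite subnn /= => Bk.
      by rewrite Bk.
    rewrite cfunZE normrM normfV normr_nat ler_pdivrMl ?ltr0Sn//.
    apply: le_trans (vB k kappa Lkk nB) _.
    rewrite [in leRHS](splitr eps) mulrDr lerD2l.
    rewrite ler_pdivrMr// in Hm.
    apply: (@le_trans _ _ (kappa.+1%:R * sigma)).
      by rewrite ler_wpM2r// ler_nat.
    by apply: le_trans Hm _; rewrite ler_wpM2r ?ler_nat// ltW.
- have [i Li] := derivative_osup_eq0 K_compact cL L0.
  apply: (IH i) => // b bi; apply: ch; exact: (@ole_osup _ i0 _ _ i).
Qed.

End SmallCombinations.

(** * Trees of strictly decreasing sequences of ordinals *)

Section OrdinalTree.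
Implicit Types (a b : ord) (s t : seq ord).

Fixpoint descending a t : Prop :=
  if t is b :: t' then olt b a /\ descending b t' else True.

Definition ordinal_tree a : set (seq ord) :=
  [set t | t <> [::] /\ descending a t].

Lemma descending_cat a s t :
  descending a (s ++ t) <-> descending a s /\ descending (last a s) t.
Proof. by elim: s a => [|b s IH] a /=; [tauto|rewrite IH; tauto]. Qed.

Lemma descending_rcons a t b :
  descending a (rcons t b) <-> descending a t /\ olt b (last a t).
Proof. by rewrite -cats1 descending_cat /=; tauto. Qed.

Lemma descending_last a t : descending a t -> ole (last a t) a.
Proof.
elim: t a => [|b t IH] a /=; first by move=> _; exact: ole_refl.
by move=> [ba /IH tb]; exact: ole_trans tb (oltW ba).
Qed.

Lemma ordinal_tree_is_tree a : is_tree (ordinal_tree a).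
Proof.
split=> [t []//|s t [_ dt] s0 [u tu]]; split=> //.
by move: dt; rewrite tu descending_cat => -[].
Qed.

(** A node with last entry above [b] has the extension by [b], which survives [b] derivations;
    conversely a surviving proper extension ends with an entry at least [b] and below the last entry
    of the node. *)
Lemma derivative_ordinal_tree a b t :
  derivative (@tree_derivative ord) (ordinal_tree a) b t <->
  ordinal_tree a t /\ ole b (last a t).
Proof.
elim: b t => [|b IH|I i0 f IH] t /=; first by tauto.
- rewrite tree_derivativeP; split.
    move=> [/IH [Tt _] [s [/IH [[_ ds] bs] [u su] nst]]]; split=> //.
    case: u su => [|z u] su; first by case: nst; rewrite su cats0.
    move: ds bs; rewrite su descending_cat last_cat /= => -[_ [zt du]] bu.
    exact: ole_olt_trans (ole_trans bu (descending_last du)) zt.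
  move=> [Tt bt]; split; first by apply/IH; split=> //; exact: oltW.
  exists (rcons t b); split.
  + apply/IH; split; last by rewrite last_rcons; exact: ole_refl.
    by split; [by case: (t)|apply/descending_rcons; split=> //; case: Tt].
  + exact: initial_segment_rcons.
  + by move=> /(congr1 size); rewrite size_rcons; lia.
- split=> [H|[Tt H] i _]; last by apply/IH; split=> //; exact: H.
  split; first by case/IH: (H i0 Logic.I).
  by move=> i; case/IH: (H i Logic.I).
Qed.

Lemma ordinal_tree_order a : has_tree_order (ordinal_tree a) a.
Proof.
split.
  rewrite -subset0 => -[|b t]; first by move=> /derivative_ordinal_tree [[]].
  move=> /derivative_ordinal_tree [[_ [ba dt]] at_].
  exact: olt_geF ba (ole_trans at_ (descending_last dt)).
move=> b ba T0; have : set0 [:: b]; last by [].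
rewrite -T0; apply/derivative_ordinal_tree; split=> //=; exact: ole_refl.
Qed.

End OrdinalTree.

(** * Weighted supremum norms *)

Section WeightedNorms.
Variables (R : realType) (F : numFieldType) (e : {rmorphism R -> F}).
Hypothesis e_le : {mono e : a b / a <= b}.
Hypothesis e_real : forall z : F, z \is Num.real -> exists a, z = e a.
Variable K : topologicalType.
Hypothesis K_nonempty : [set: K] !=set0.
Hypothesis K_compact : compact [set: K].
Implicit Types f g : cfun K F.

Lemma cfun_bounded f : exists M : F, forall k, `|f k| <= M.
Proof.
have /compact_near_coveringP cvK := K_compact.
have [] // := @filter_ex _ \oo _ (fun n => [set: K] `<=` (fun k => `|f k| <= n%:R)).
  apply: (cvK nat \oo (fun n k => `|f k| <= n%:R)) => k _.
  have [|m Hm] := real_arch e_le e_real (z := `|f k| + 1).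
    by rewrite ger0_real// addr_ge0.
  exists ([set q | `|f k - f q| < 1], [set n | (m <= n)%N]) => /=.
    split; last by exists m.
    have /cvgr_dist_lt : f @ k --> f k by exact: cts_fun.
    exact.
  move=> [q n] [/= qk mn]; apply: (@le_trans _ _ (`|f k| + 1)).
    rewrite -{1}(subKr (f k) (f q)); apply: le_trans (ler_normB _ _) _.
    by rewrite lerD2l ltW.
  by apply: le_trans Hm _; rewrite ler_nat.
by move=> n Hn; exists n%:R => k; exact: Hn.
Qed.

Section Weight.
Variables (u : K -> F) (m : F).
Hypothesis u_ge1 : forall k, 1 <= u k.
Hypothesis u_le : forall k, u k <= m.

Let u_ge0 k : 0 <= u k. Proof. exact: le_trans ler01 (u_ge1 k). Qed.

Let values f : set F := range (fun k => u k * `|f k|).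

Let values_real f z : values f z -> z \is Num.real.
Proof. by move=> [k _ <-]; rewrite ger0_real// mulr_ge0. Qed.

Let values_ubound f : exists M, ubound (values f) M.
Proof.
have [M HM] := cfun_bounded f; exists (m * M) => _ [k _ <-].
by rewrite ler_pM.
Qed.

Definition weighted_norm_fun f : F := supremum 0 (values f).

Lemma weighted_norm_ge f k : u k * `|f k| <= weighted_norm_fun f.
Proof.
have [M HM] := values_ubound f.
by apply: (supremum_ubound e_le e_real _ HM); [exact: values_real|exists k].
Qed.

Lemma weighted_norm_le f b : (forall k, u k * `|f k| <= b) ->
  weighted_norm_fun f <= b.
Proof.
move=> H; apply: (supremum_le e_le e_real); last by move=> _ [k _ <-].
  by have [k _] := K_nonempty; exists (u k * `|f k|), k.
exact: values_real.
Qed.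

Lemma weighted_norm_eval f k : `|f k| <= weighted_norm_fun f.
Proof. by apply: le_trans (weighted_norm_ge f k); rewrite ler_peMl. Qed.

Let triangle f g :
  weighted_norm_fun (f + g) <= weighted_norm_fun f + weighted_norm_fun g.
Proof.
apply: weighted_norm_le => k; rewrite cfunDE.
apply: (@le_trans _ _ (u k * `|f k| + u k * `|g k|)).
  by rewrite -mulrDr ler_wpM2l// ler_normD.
by rewrite lerD// weighted_norm_ge.
Qed.

Let scale_le (a : F) f : weighted_norm_fun (a *: f) <= `|a| * weighted_norm_fun f.
Proof.
apply: weighted_norm_le => k; rewrite cfunZE normrM mulrCA ler_wpM2l//.
exact: weighted_norm_ge.
Qed.

Let scale (a : F) f : weighted_norm_fun (a *: f) = `|a| * weighted_norm_fun f.
Proof.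
apply/eqP; rewrite eq_le scale_le /=; have [->|a0] := eqVneq a 0.
  have [k _] := K_nonempty; rewrite normr0 mul0r.
  exact: le_trans (normr_ge0 _) (weighted_norm_eval _ k).
rewrite -ler_pdivlMl ?normr_gt0// -normfV.
by rewrite -{1}[f](scalerK a0); exact: scale_le.
Qed.

Let eq0 f : weighted_norm_fun f = 0 -> f = 0.
Proof.
move=> f0; apply/continuousEP => k; apply/eqP; rewrite -normr_le0 -f0.
exact: weighted_norm_eval.
Qed.

Definition weighted_norm : norm_on (cfun K F) := NormOn triangle scale eq0.

End Weight.

Lemma sup_normE f : sup_norm f = weighted_norm_fun (fun=> 1) f.
Proof.
by rewrite /sup_norm /weighted_norm_fun; under [in RHS]eq_fun do rewrite mul1r.
Qed.

Lemma sup_norm_ge f k : `|f k| <= sup_norm f.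
Proof. by rewrite sup_normE; exact: (@weighted_norm_eval _ 1). Qed.

Lemma sup_norm_le f b : (forall k, `|f k| <= b) -> sup_norm f <= b.
Proof.
move=> H; rewrite sup_normE; apply: (@weighted_norm_le (fun=> 1)) => // k.
by rewrite mul1r.
Qed.

End WeightedNorms.

(** * Point evaluations as continuous functionals *)

Section Evaluation.
Variables (F : numFieldType) (K : topologicalType) (N : norm_on (cfun K F)).

Definition cfun_eval (k : K) : renormed N -> F^o := fun f => (f : cfun K F) k.

Lemma cfun_eval_is_linear k : linear (cfun_eval k).
Proof. by []. Qed.

HB.instance Definition _ k :=
  GRing.isLinear.Build F (renormed N) F^o _ (cfun_eval k) (cfun_eval_is_linear k).

Lemma cfun_eval_continuous k : (forall f : cfun K F, `|f k| <= N f) ->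
  continuous (cfun_eval k).
Proof.
move=> H; apply: (@bounded_linear_continuous F (renormed N) F^o (cfun_eval k)).
by apply/bounded_funP => r; exists r => f; apply: le_trans; exact: H.
Qed.

End Evaluation.

(** * Flatness of a weighted norm when some level is empty *)

Section Flat.
Variables (R : realType) (F : numFieldType) (e : {rmorphism R -> F}).
Hypothesis e_le : {mono e : a b / a <= b}.
Hypothesis e_real : forall z : F, z \is Num.real -> exists a, z = e a.
Variable K : topologicalType.
Hypothesis K_nonempty : [set: K] !=set0.
Hypothesis K_compact : compact [set: K].
Variables (xi : ord) (n : nat).

Local Notation CBd := (derivative (@CB_derivative K)).
Local Notation level i := (CBd [set: K] (omul (oexp omega xi) (onat i))).

Hypothesis level_n : level n = set0.

Lemma level_anti i j : (i <= j)%N -> level j `<=` level i.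
Proof.
move=> ij; apply: derivative_anti (ole_omul_onat _ ij).
  exact: CB_derivative_sub.
exact: CB_derivative_mono.
Qed.

(** Levels decrease, so those containing [k] are counted by the least [m] with [k] outside level
    [m]; it is positive because level 0 is the whole space. *)
Lemma level_weight k :
  exists m, [/\ (0 < m)%N, (m <= n)%N & forall i, level i k <-> (i < m)%N].
Proof.
have ex : exists m, `[< ~ level m k >].
  by exists n; apply/asboolP; rewrite level_n.
have [m /asboolP Hm minm] := find_ex_minn ex.
exists m; split.
- by rewrite lt0n; apply/eqP => m0; apply: Hm; rewrite m0.
- by apply: minm; apply/asboolP; rewrite level_n.
- move=> i; split=> [ik|im].
    by rewrite ltnNge; apply/negP => mi; apply: Hm; exact: level_anti mi _ ik.
  by apply: contrapT => /asboolP/minm; rewrite leqNgt im.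
Qed.

Lemma flat_norm_ex : exists N : norm_on (cfun K F),
  equivalent_norms N (@sup_norm K F) /\ auf_space xi (renormed N).
Proof.
have [wt Hwt] := choice level_weight.
have wt0 k : (0 < wt k)%N by have [] := Hwt k.
have wtn k : (wt k <= n)%N by have [] := Hwt k.
have wtP i k : level i k <-> (i < wt k)%N by have [_ _] := Hwt k; exact.
have [k0 _] := K_nonempty.
have n0 : (0 < n)%N by exact: leq_trans (wt0 k0) (wtn k0).
pose u k : F := (wt k)%:R.
have u1 k : 1 <= u k by rewrite ler1n.
have un k : u k <= n%:R by rewrite ler_nat.
pose N := weighted_norm e_le e_real K_nonempty K_compact u1 un.
have Nge (f : cfun K F) k : u k * `|f k| <= N f.
  exact: (weighted_norm_ge e_le e_real K_compact u1 un).
have Nle (f : cfun K F) b : (forall k, u k * `|f k| <= b) -> N f <= b.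
  exact: (weighted_norm_le e_le e_real K_nonempty u1).
have Neval (f : cfun K F) k : `|f k| <= N f.
  exact: (weighted_norm_eval e_le e_real K_compact u1 un).
exists N; split.
  exists 1, n%:R; split=> [||f]; rewrite ?ltr01 ?ltr0n//.
  rewrite mul1r; apply/andP; split.
    exact: (sup_norm_le e_le e_real K_nonempty).
  by apply: Nle => k; rewrite ler_pM// (sup_norm_ge e_le e_real K_compact).
(* Smaller than the gap between [1 / i.+1] and [1 / i.+2] for every [i < n]. *)
pose sigma : F := (n.+1%:R ^+ 2)^-1.
have sigma0 : 0 < sigma by rewrite invr_gt0 exprn_gt0.
exists sigma; split=> //.
pose one : cfun K F := mkcts (@cst_continuous K F 1).
have N1 : 0 < N one.
  by apply: lt_le_trans (Neval one k0); rewrite normr1.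
rewrite /rho asboolF; last first.
  move=> /(_ one) /= one0.
  have : N one = 0 by rewrite one0; exact: (@normr0 F (renormed N)).
  by move/eqP; rewrite gt_eqF.
set S := (X in supremum 0 X).
have values_real (X : set (renormed N)) (y : renormed N) z :
    [set `|y + v| - 1 | v in X] z -> z \is Num.real.
  by move=> [v _ <-]; rewrite realB// ?normr_real// real1.
have values_lb (X : set (renormed N)) (y : renormed N) :
    lbound [set `|y + v| - 1 | v in X] (- 1).
  by move=> _ [v _ <-]; rewrite lerDr.
apply: supremum_max.
  (* The value 0 is attained by a [y] of norm one and the zero collection over a one-point directed
     set. *)
  exists ((N one)^-1 *: one : renormed N), ord, (ordinal_tree (oexp omega xi)).
  pose D1 : directed_set := @DirectedSet unit (fun _ _ => True) (inhabits tt)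
    (fun _ => Logic.I) (fun _ _ _ _ _ => Logic.I)
    (fun _ _ => ex_intro _ tt (conj Logic.I Logic.I)).
  exists D1, (fun=> 0); split.
  - by rewrite normrZ normfV gtr0_norm// mulVf ?gt_eqF.
  - by split; [exact: ordinal_tree_is_tree|exact: ordinal_tree_order].
  - by move=> t _; rewrite normr0 ltW.
  - move=> t _ z _ f _; rewrite linear0; exact: cvg_cst.
  - set I := [set _ | _ in _]; suff -> : I = [set 0] by rewrite infimum_set1.
    apply/seteqP; split.
      move=> _ [v [t _ [m [w [a [_ _ Aa ->]]]]] <-] /=.
      rewrite big1 ?addr0; last by move=> i _; have [s _ <-] := Aa i; rewrite scaler0.
      by rewrite normrZ normfV gtr0_norm// mulVf ?gt_eqF// subrr.
    move=> _ ->; exists 0; last first.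
      by rewrite addr0 normrZ normfV gtr0_norm// mulVf ?gt_eqF// subrr.
    exists [:: (OZero, tt)].
      by split=> //=; split=> //; exact: oexp_omega_gt0.
    apply: weighted_sums1; exists [:: (OZero, tt)] => //; split=> //.
    exact: initial_segment_refl.
move=> r [y [Lambda [T [D [x [y1 [treeT ordT] xs xnull ->]]]]]].
set I := [set _ | _ in _].
have [T_sub T_ne] := ordT.
(* Below the order of [T] its derivatives are non-empty trees, and the first entries of their
   members are the required children of the root. *)
have has_root : has_children_at T (D := D) [::] OZero (oexp omega xi).
  move=> b bw; rewrite oadd0; apply: contrapT => nz; apply: (T_ne b bw).
  rewrite -subset0 => -[|z t] Tt.
    by case: (proj1 (derivative_tree b treeT) _ Tt).
  apply: nz; exists z; apply: (proj2 (derivative_tree b treeT)) Tt _ _ => //.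
  by exists t.
suff small eps : 0 < eps -> exists2 z, I z & z <= n%:R * eps.
  have [z0 Iz0 _] := small 1 ltr01.
  have I0 : I !=set0 by exists z0.
  have rr := infimum_real e_le e_real I0 (@values_real _ y) (values_lb _ y).
  rewrite real_leNgt//; apply/negP => r0.
  have n2 : 0 < n%:R * 2 :> F by rewrite mulr_gt0 ?ltr0n.
  (* With this tolerance some value would be at most half of the positive infimum. *)
  have [z Iz] := small (infimum 0 I / (n%:R * 2)) (divr_gt0 r0 n2).
  have := infimum_lbound e_le e_real (@values_real _ y) (values_lb _ y) Iz.
  move=> /le_trans H /H; rewrite mulrCA invfM mulVKf ?pnatr_eq0 -?lt0n//.
  by rewrite ler_pdivlMr// -[leRHS]mulr1 ler_pM2l// (ler_nat F 2 1).
move=> eps0.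
have y1' k : u k * `|(y : cfun K F) k| <= 1 by apply: le_trans (Nge y k) y1.
(* [C i] holds the points of level [i] where adding [sigma] may push [y] above [1 / i.+1]. On level
   [i.+1] the weight is at least [i.+2], so [y] is at most [1 / i.+2] there, and the derivative of
   [C i] of order [oexp omega xi] is empty. *)
pose C i := level i `&` [set k | ~~ (`|(y : cfun K F) k| < i.+1%:R^-1 - sigma)].
have [i iN|L [cL L0 CL]] := @closed_finite_union K C (oexp omega xi) n.
  have cy : closed [set k | ~~ (`|(y : cfun K F) k| < i.+1%:R^-1 - sigma)].
    exact: closed_norm_ge.
  have clevel : closed (level i) by apply: derivative_closed; exact: closedT.
  split; first exact: closedI.
  rewrite -subset0 => k Ck.
  have [_ /negP] := derivative_sub (@CB_derivative_sub K) Ck; apply.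
  have : level i.+1 k.
    rewrite omulS derivative_oadd.
    by apply: derivative_mono Ck; [exact: CB_derivative_mono|move=> q []].
  move=> /wtP iwt.
  have yk : `|(y : cfun K F) k| <= i.+2%:R^-1.
    rewrite -[leRHS]mul1r ler_pdivlMr// mulrC; apply: le_trans (y1' k).
    by rewrite ler_wpM2r// ler_nat.
  apply: le_lt_trans yk _; rewrite ltrBrDr -ltrBrDl.
  have -> : i.+1%:R^-1 - i.+2%:R^-1 = (i.+1%:R * i.+2%:R)^-1 :> F.
    rewrite -[i.+2]addn1 natrD; field.
    by rewrite nat1r natr1 !pnatr_eq0.
  rewrite ltf_pV2 ?posrE ?exprn_gt0 ?mulr_gt0//.
  by rewrite -natrM -natrX ltr_nat; have := wtn k; nia.
have [||t [v [Tt _ sv vL]]] := @small_combination_exp F K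
    (real_arch e_le e_real) K_compact Lambda T D x sigma treeT (ltW sigma0) _ _
    xi L OZero [::] eps cL L0 (or_intror erefl) has_root eps0.
- by move=> t Tt k; apply: le_trans (Neval _ k) (xs t Tt).
- move=> t nt z nz k; apply: (xnull t nt z nz (@cfun_eval F K N k)).
  by apply: cfun_eval_continuous => f; exact: Neval.
exists (`|y + (v : renormed N)| - 1).
  exists (v : renormed N) => //; exists t => //.
  apply: weighted_sums_mono sv => _ [s [_ s0 st] <-]; exists s => //.
rewrite lerBlDr; apply: Nle => k; rewrite cfunDE.
have vk : `|v k| <= sigma.
  have xk s (Ts : tree_dir T D s) q : `|(x s : cfun K F) q| <= sigma.
    exact: le_trans (Neval _ q) (xs s Ts).
  by have := between_weighted_le treeT xk k Tt sv; rewrite mul1r.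
apply: (@le_trans _ _ (u k * `|(y : cfun K F) k| + u k * `|v k|)).
  by rewrite -mulrDr ler_wpM2l ?ler0n// ler_normD.
(* On [L] the combination itself is small. Outside [L] it is absorbed by the room of [sigma] left
   below [1 / i.+1], where [i.+1] is the weight of [k]. *)
have [Lk|nLk] := pselect (L k).
  by rewrite addrC lerD// ler_pM ?ler0n// vL.
apply: (@le_trans _ _ 1); last by rewrite lerDr mulr_ge0// ltW.
have [i wi] : exists i, wt k = i.+1 by exists (wt k).-1; rewrite prednK.
have yk : `|(y : cfun K F) k| < i.+1%:R^-1 - sigma.
  apply: contrapT => /negP yk; apply: nLk; apply: (CL i).
    by have := wtn k; rewrite wi.
  by split=> //; apply/wtP; rewrite wi.
apply: (@le_trans _ _ (u k * (i.+1%:R^-1 - sigma) + u k * sigma)).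
  by rewrite lerD// ler_wpM2l ?ler0n// ltW.
by rewrite -mulrDr subrK /u wi mulfV ?pnatr_eq0.
Qed.

End Flat.

(** * Weakly null trees of bump functions *)

Section BumpNets.
Variables (F : numFieldType) (K : topologicalType).
Hypothesis F_arch : forall z : F, z \is Num.real -> exists n : nat, z <= n%:R.

(* If the functional [f] stayed away from 0 along the net, adding up members of
   the net with disjoint supports would make [f] unbounded on a ball. *)
Lemma bump_net_weakly_null (N : norm_on (cfun K F)) (C s : F) (D : directed_set)
    (z : D -> cfun K F) (q : K) :
  0 <= s -> (forall (f : cfun K F) b, (forall k, `|f k| <= b) -> N f <= C * b) ->
  (forall u k, `|z u k| <= s) ->
  (forall u, exists2 O, nbhs q O & forall k, O k -> z u k = 0) ->
  (forall O, nbhs q O ->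
     exists u0, forall u, dle u0 u -> forall k, ~ O k -> z u k = 0) ->
  weakly_null_net (X := renormed N) z.
Proof.
move=> s0 NC zs zq zO f fc; apply/cvgr0Pnorm_le => eps eps0.
apply: contrapT => nnear.
have far u0 : exists u, dle u0 u /\ eps < `|f (z u)|.
  apply: contrapT => /forallNP H; apply: nnear; exists u0 => // u u0u.
  rewrite /= real_leNgt ?normr_real ?gtr0_real//; apply/negP => fz.
  exact: (H u).
have sums (m : nat) : exists y : cfun K F, [/\ forall k, `|y k| <= s,
    exists2 O, nbhs q O & forall k, O k -> y k = 0
    & m%:R * eps <= f (y : renormed N)].
  elim: m => [|m [y [ys [W qW yW] fy]]].
    exists 0; split; first by move=> k; rewrite normr0.
      by exists setT => //; exact: filterT.
    by rewrite mul0r linear0.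
  (* Far along the net [z u] vanishes outside [W], while [y] vanishes on [W]; the supports are
     disjoint and the bound [s] persists. *)
  have [u0 Hu0] := zO W qW; have [u [u0u epsu]] := far u0.
  have fz0 : f (z u) != 0 by rewrite -normr_gt0; exact: lt_trans epsu.
  (* A unimodular factor that turns [f (z u)] into its modulus. *)
  pose c := `|f (z u)| / f (z u).
  have c1 : `|c| = 1 by rewrite normrM normfV normr_id mulfV ?normr_eq0.
  have [W' qW' zW'] := zq u.
  exists (y + c *: z u); split.
  - move=> k; rewrite cfunDE cfunZE.
    have [Wk|nWk] := pselect (W k).
      by rewrite yW// add0r normrM c1 mul1r.
    by rewrite (Hu0 u u0u k nWk) mulr0 addr0.
  - exists (W `&` W'); first exact: filterI.
    by move=> k [Wk Wk']; rewrite cfunDE cfunZE yW// zW'// mulr0 addr0.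
  - rewrite [f _](linearD f (y : renormed N)) linearZ /= -addn1 natrD mulrDl mul1r.
    by rewrite lerD// /c /GRing.scale /= divfK// ltW.
have /bounded_funP/(_ (C * s)) [M HM] : bounded_near f (nbhs (0 : renormed N)).
  by apply/linear_bounded_continuous.
have [y0 [y0s _ _]] := sums 0%N.
have Mr : M \is Num.real.
  by rewrite ger0_real// (le_trans _ (HM y0 _))// NC.
have [n Hn] : exists n : nat, M / eps + 1 <= n%:R.
  by apply: F_arch; rewrite realD// realM// realV gtr0_real.
have [y [ys _ fy]] := sums n.
have fM : f (y : renormed N) <= M.
  apply: le_trans (HM y _); last exact: NC.
  apply: real_ler_norm; rewrite -(ler_real fy).
  by rewrite realM// gtr0_real.
have := le_trans fy fM; rewrite -ler_pdivlMr// => /(le_trans Hn).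
by rewrite gerDl lt_geF.
Qed.

End BumpNets.

(** * The directed set of neighbourhood assignments *)

Section NeighbourhoodAssignments.
Variable K : topologicalType.

(** A single directed set must serve all nodes of a tree, whose bumps concentrate at different
    points; its elements therefore prescribe a neighbourhood of every point at once. *)
Definition nbhs_assignment : Type := {u : K -> set K | forall p, nbhs p (u p)}.

Definition nbhs_assignment_le (u v : nbhs_assignment) : Prop :=
  forall p, sval v p `<=` sval u p.

Lemma nbhs_assignment_inhabited : inhabited nbhs_assignment.
Proof. by constructor; exists (fun=> setT) => p; exact: filterT. Qed.

Lemma nbhs_assignment_trans u v w : nbhs_assignment_le u v ->
  nbhs_assignment_le v w -> nbhs_assignment_le u w.
Proof. by move=> uv vw p; exact: subset_trans (vw p) (uv p). Qed.

Lemma nbhs_assignment_directed u v : exists w,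
  nbhs_assignment_le u w /\ nbhs_assignment_le v w.
Proof.
case: u v => [u up] [v vp].
have wp p : nbhs p (u p `&` v p) by exact: filterI.
by exists (exist _ (fun p => u p `&` v p) wp); split=> p k [].
Qed.

Definition nbhs_assignments : directed_set :=
  @DirectedSet nbhs_assignment nbhs_assignment_le nbhs_assignment_inhabited
    (fun u p => @subset_refl _ (sval u p)) nbhs_assignment_trans
    nbhs_assignment_directed.

Lemma nbhs_assignment_at (q : K) (O : set K) : nbhs q O ->
  exists u : nbhs_assignments, sval u q `<=` O.
Proof.
(* The assignment equals [O] at [q] and the whole space at every other point. *)
move=> qO; have up p : nbhs p [set k | p = q -> O k].
  have [->|pq] := pselect (p = q); first by apply: filterS qO => k Ok _.
  by apply: filterS filterT => k _ /pq.
by exists (exist _ (fun p => [set k | p = q -> O k]) up) => k; exact.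
Qed.

End NeighbourhoodAssignments.

(** * A tree of bumps bounded below along its branches *)

Section BumpTree.
Variables (R : realType) (F : numFieldType) (e : {rmorphism R -> F}).
Hypothesis e_le : {mono e : a b / a <= b}.
Hypothesis e_real : forall z : F, z \is Num.real -> exists a, z = e a.
Variable K : topologicalType.
Hypothesis K_compact : compact [set: K].
Hypothesis K_hausdorff : hausdorff_space K.

Local Notation CBd := (derivative (@CB_derivative K)).

(** An ordered embedding preserves absolute values, and every positive [eps] of [F] is the image of
    a positive real. *)
Lemma embedding_continuous : continuous (e : R -> F).
Proof.
move=> a; apply/cvgrPdist_le => eps eps0.
have [b eb] := e_real (gtr0_real eps0).
have b0 : 0 < b.
  by rewrite ltNge -e_le -eb rmorph0 lt_geF.
have /cvgr_dist_le/(_ b b0) : id @ a --> a by exact: cvg_id.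
apply: filterS => c /=; rewrite -rmorphB eb -e_le; congr is_true.
congr (_ <= _); rewrite -(rmorph0 e) in eps0 *.
have [ac|/ltW ac] := leP 0 (a - c).
  by rewrite !ger0_norm// -(rmorph0 e) e_le.
by rewrite !ler0_norm// ?rmorphN// -(rmorph0 e) e_le.
Qed.

(** Disjoint neighbourhoods [A] of [q'] and [B] of [q] confine a Urysohn function to the part of [W]
    in [A], away from [q]. It is scaled by [s], and [V] is where it exceeds one half before
    scaling. *)
Lemma bump (q q' : K) (W : set K) (s : F) : q' <> q -> open W -> W q' -> 0 <= s ->
  exists (g : cfun K F) V, [/\ open V, V q', V `<=` W & forall k, `|g k| <= s] /\
    [/\ forall k, V k -> s / 2 <= g k, forall k, ~ W k -> g k = 0
      & exists2 O, nbhs q O & forall k, O k -> g k = 0].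
Proof.
move=> /eqP q'q oW Wq' s0.
have := K_hausdorff; rewrite open_hausdorff => /(_ q' q q'q).
move=> [[A B] /= [q'A qB] [oA oB /eqP AB]].
pose W' := W `&` A.
have oW' : open W' by exact: openI.
have W'q' : W' q' by split=> //; exact/set_mem.
have /(@normal_separatorP R K) := compact_normal K_hausdorff K_compact.
have cq' : closed [set q'].
  exact: (accessible_closed_set1 (hausdorff_accessible K_hausdorff)).
move=> /(_ (~` W') [set q'] (open_closedC oW') cq').
case; first by rewrite -subset0 => k [nW' /= kq']; apply: nW'; rewrite kq'.
move=> unif sep.
have /(@uniform_separatorP _ R) [f [fc f01 f0 f1]] :
  uniform_separator (~` W') [set q'] by exists unif.
have fge0 k : 0 <= f k by have /f01 := imageT f k; rewrite /= in_itv => /andP [].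
have fle1 k : f k <= 1 by have /f01 := imageT f k; rewrite /= in_itv => /andP [].
have fW' k : ~ W' k -> f k = 0 by move=> nW'; apply: f0; exists k.
have fq' : f q' = 1 by apply: f1; exists q'.
have gc : continuous (fun k => s * e (f k) : F).
  move=> k; apply: cvgMr; apply: (@continuous_comp _ _ _ f e); first exact: fc.
  exact: embedding_continuous.
exists (mkcts gc : cfun K F), (W' `&` f @^-1` [set r | 2^-1 < r]); split; split.
- apply: openI => //; apply: open_comp; last exact: open_gt.
  by move=> k _; exact: fc.
- by split=> //=; rewrite fq' invf_lt1// ltr1n.
- by move=> k [[]].
- move=> k; rewrite /mkcts normrM !ger0_norm//; last first.
    by rewrite -(rmorph0 e) e_le.
  by rewrite -[leRHS]mulr1 ler_wpM2l// -(rmorph1 e) e_le.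
- move=> k [_ /= /ltW fk]; rewrite /mkcts ler_wpM2l//.
  by rewrite -(rmorph_nat e 2) -fmorphV e_le.
- move=> k nW; change (s * e (f k) = 0); rewrite fW' ?rmorph0 ?mulr0//.
  by move=> [].
- exists B; first by apply: open_nbhs_nbhs; split=> //; exact/set_mem.
  move=> k Bk; change (s * e (f k) = 0); rewrite fW' ?rmorph0 ?mulr0// => -[_ Ak].
  by have : (A `&` B) k by []; rewrite AB.
Qed.

Variables (L : set K) (a : ord) (p : K) (V0 : set K) (s : F).

Local Notation D := (nbhs_assignments K).

Hypotheses (Lp : CBd L a p) (V0_open : open V0) (V0p : V0 p) (s_ge0 : 0 <= s).

(** A state is the current point, an open neighbourhood of it and the last bump. In [next] the new
    bump lives in the neighbourhood assigned to the old point but vanishes near that point. *)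
Let state : Type := (K * set K * cfun K F)%type.

Let next (st : state) (c : ord * D) (st' : state) : Prop :=
  [/\ CBd L c.1 st'.1.1, open st'.1.2, st'.1.2 st'.1.1 & st'.1.2 `<=` st.1.2] /\
  [/\ forall k, `|st'.2 k| <= s, forall k, st'.1.2 k -> s / 2 <= st'.2 k,
      forall k, ~ sval c.2 st.1.1 k -> st'.2 k = 0
    & exists2 U, nbhs st.1.1 U & forall k, U k -> st'.2 k = 0].

(** The premises stand under the existential quantifier so that [choice] gives a step defined on all
    states. The new point exists because the old one is a limit of other points of the derivative of
    order [c.1]. *)
Let next_ex st c : exists st', CBd L (OSucc c.1) st.1.1 -> open st.1.2 ->
  st.1.2 st.1.1 -> next st c st'.
Proof.
case: st c => -[q V] g [b [u up]]; rewrite /next /=.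
have [[Lq oV Vq]|H] := pselect [/\ CB_derivative (CBd L b) q, open V & V q];
  last by exists (q, V, g) => Lq oV Vq; case: H.
have oW : open (V `&` (u q)°) by apply: openI => //; exact: open_interior.
have /CB_derivativeP [_ /(_ (V `&` (u q)°)) []] := Lq.
  by apply: open_nbhs_nbhs; split=> //; split=> //; exact: up.
move=> q' [Wq' Lq' q'q].
have [g' [V' [[oV' V'q' V'W g's] [g'V' g'W g'q]]]] :=
  bump q'q oW Wq' s_ge0.
exists (q', V', g') => _ _ _; split; split=> //=.
  by move=> k /V'W [].
by move=> k nuk; apply: g'W => -[_ /interior_subset].
Qed.

Lemma bump_tree_ex : exists x : seq (ord * D) -> cfun K F,
  [/\ forall t, tree_dir (ordinal_tree a) D t -> forall k, `|x t k| <= s,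
      forall (N : norm_on (cfun K F)) C,
        (forall (f : cfun K F) b, (forall k, `|f k| <= b) -> N f <= C * b) ->
        weakly_null_collection (X := renormed N) (ordinal_tree a) x
    & forall t, tree_dir (ordinal_tree a) D t -> exists V,
        [/\ open V, V `<=` V0, exists2 q, L q & V q
          & forall g, branch x t g -> forall k, V k -> s / 2 <= g k]].
Proof.
have [step stepP] := choice (fun sc : state * (ord * D) => next_ex sc.1 sc.2).
pose st t := foldl (fun st c => step (st, c)) (p, V0, 0 : cfun K F) t.
have st_rcons t c : st (rcons t c) = step (st t, c) by rewrite /st foldl_rcons.
(* Neighbourhoods shrink along a branch, so on the last one every earlier bump keeps its lower bound
   [s / 2]. The current point lies in the derivative whose order is the last entry, or [a] at the
   root. *)
have inv t : descending a (unzip1 t) ->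
    [/\ open (st t).1.2, (st t).1.2 (st t).1.1, (st t).1.2 `<=` V0,
        CBd L (last a (unzip1 t)) (st t).1.1
      & forall r, r <> [::] -> initial_segment r t ->
          forall k, (st t).1.2 k -> s / 2 <= (st r).2 k].
  elim/last_ind: t => [_|t [b u] IH].
    by split=> // r r0 [w] /esym /(congr1 size); rewrite size_cat; case: r r0.
  rewrite unzip1_rcons last_rcons => /descending_rcons [/IH [oV Vq VV0 Lq Vr] bt].
  have [|[Lq' oV' V'q' V'V] [gs gV' gu gq]] := stepP (st t, (b, u)) _ oV Vq.
    exact: (derivative_anti (@CB_derivative_sub K) (@CB_derivative_mono K) bt).
  rewrite st_rcons; split=> //; first exact: subset_trans V'V VV0.
  move=> r r0 [w]; case: (lastP w) => [|w' c] rw k V'k.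
    by rewrite cats0 in rw; rewrite -rw st_rcons; exact: gV'.
  apply: Vr => //; last exact: V'V.
  by exists w'; move: rw; rewrite -rcons_cat => /rcons_inj [].
have nextP t b u : descending a (rcons (unzip1 t) b) ->
    next (st t) (b, u) (st (rcons t (b, u))).
  move=> /descending_rcons [/inv [oV Vq _ Lq _] bt]; rewrite st_rcons.
  apply: stepP => //.
  exact: (derivative_anti (@CB_derivative_sub K) (@CB_derivative_mono K) bt).
exists (fun t => (st t).2); split.
- move=> t; case: (lastP t) => [[]//|t' [b u]] [_]; rewrite unzip1_rcons.
  by move=> /(@nextP _ _ u) [_ []].
- move=> N C NC t nt b nb.
  have next' u : next (st t) (b, u) (st (rcons t (b, u))).
    by have [_] := nb u; rewrite unzip1_rcons; exact: nextP.
  apply: (bump_net_weakly_null (real_arch e_le e_real) s_ge0 NC (q := (st t).1.1)).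
  + by move=> u k; have [_ []] := next' u.
  + by move=> u; have [_ []] := next' u.
  + move=> U qU; have [u0 u0U] := nbhs_assignment_at qU; exists u0 => u u0u k nUk.
    have [_ [_ _ gu _]] := next' u; apply: gu => uk; apply: nUk.
    by apply: u0U; exact: u0u.
- move=> t [_ dt]; have [oV Vq VV0 Lq Vr] := inv t dt.
  exists (st t).1.2; split=> //.
    by exists (st t).1.1 => //; exact: (derivative_sub (@CB_derivative_sub K)) Lq.
  by move=> _ [r [r0 rt] <-] k; exact: Vr.
Qed.

End BumpTree.

(** * Flat norms bound the index *)

Section NotFlat.
Variables (R : realType) (F : numFieldType) (e : {rmorphism R -> F}).
Hypothesis e_le : {mono e : a b / a <= b}.
Hypothesis e_real : forall z : F, z \is Num.real -> exists a, z = e a.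

(** The supremum is taken over a set bounded by [sigma], so its vanishing makes each infimum at most
    0, and some value lies below [delta]. The vector [v0] excludes the zero operator, for which
    [rho] is 0 by convention. *)
Lemma rho_eq0_ex (X : normedModType F) (xi : ord) (sigma : F) (v0 : X) y
    (Lambda : Type) (T : set (seq Lambda)) (D : directed_set)
    (x : seq (Lambda * D) -> X) (delta : F) :
  v0 != 0 -> rho xi sigma (idfun : {linear X -> X}) = 0 -> `|y| <= 1 ->
  is_tree T -> has_tree_order T (oexp omega xi) ->
  (forall t, tree_dir T D t -> `|x t| <= sigma) -> weakly_null_collection T x ->
  0 < delta ->
  exists t v, [/\ tree_dir T D t, convex_hull (branch x t) v
    & `|y + v| < 1 + delta].
Proof.
move=> v00 rho0 y1 treeT ordT xs xnull delta0.
move: rho0; rewrite /rho asboolF; last by move=> /(_ v0) /eqP; exact/negP.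
set S := (X in supremum 0 X); move=> S0.
pose values (y' : X) (T' : set X) := [set `|y' + v| - 1 | v in T'].
have values_real y' T' z : values y' T' z -> z \is Num.real.
  by move=> [v _ <-]; rewrite realB// ?normr_real// real1.
have values_lb y' T' : lbound (values y' T') (- 1).
  by move=> _ [v _ <-]; rewrite lerDr.
have hull_ex (L : Type) (T' : set (seq L)) (E : directed_set)
    (x' : seq (L * E) -> X) : is_tree T' -> has_tree_order T' (oexp omega xi) ->
    (forall t, tree_dir T' E t -> `|x' t| <= sigma) ->
    exists2 v, (\bigcup_(t in tree_dir T' E) convex_hull (branch x' t)) v
      & `|v| <= sigma.
  move=> treeT' [_ /(_ OZero (oexp_omega_gt0 xi)) T'0] x's.
  have [t Tt] : T' !=set0 by apply/set0P/eqP.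
  have [u] := dinhabited E.
  have uz : unzip1 [seq (l, u) | l <- t] = t by rewrite /unzip1 -map_comp map_id.
  pose t' := [seq (l, u) | l <- t].
  exists (x' t'); last by apply: x's; rewrite /tree_dir /= uz.
  exists t'; first by rewrite /tree_dir /= uz.
  apply: weighted_sums1; exists t' => //; split; last exact: initial_segment_refl.
  by move=> t'0; apply: (proj1 treeT' t Tt); rewrite -uz -/t' t'0.
have S_real z : S z -> z \is Num.real.
  move=> [y' [L [T' [E [x' [y'1 [treeT' ordT'] x's _ ->]]]]]].
  have [v Tv vs] := hull_ex L T' E x' treeT' ordT' x's.
  apply: (infimum_real e_le e_real _ (@values_real _ _) (values_lb _ _)).
  by exists (`|y' + v| - 1), v.
have S_ub : ubound S sigma.
  move=> _ [y' [L [T' [E [x' [y'1 [treeT' ordT'] x's _ ->]]]]]].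
  have [v Tv vs] := hull_ex L T' E x' treeT' ordT' x's.
  apply: (@le_trans _ _ (`|y' + v| - 1)).
    apply: (infimum_lbound e_le e_real (@values_real _ _) (values_lb _ _)).
    by exists v.
  rewrite lerBlDr addrC; apply: le_trans (ler_normD _ _) _; exact: lerD.
pose I := values y (\bigcup_(t in tree_dir T D) convex_hull (branch x t)).
have SI : S (infimum 0 I) by exists y, Lambda, T, D, x.
have := supremum_ubound e_le e_real S_real S_ub SI; rewrite S0 => I_le0.
have [v Tv _] := hull_ex Lambda T D x treeT ordT xs.
have I0 : I !=set0 by exists (`|y + v| - 1), v.
have [_ [w [t Tt wt] <-]] := infimum_lt_ex e_le e_real I0 (@values_real _ _)
  (values_lb _ _) (le_lt_trans I_le0 delta0).
by rewrite ltrBlDl => yw; exists t, w.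
Qed.

Variable K : topologicalType.
Hypothesis K_nonempty : [set: K] !=set0.
Hypothesis K_compact : compact [set: K].
Hypothesis K_hausdorff : hausdorff_space K.
Variables (xi : ord) (N : norm_on (cfun K F)) (c C sigma : F).
Hypotheses (c_gt0 : 0 < c) (C_gt0 : 0 < C) (sigma_gt0 : 0 < sigma).
Hypothesis N_equiv : forall f, c * sup_norm f <= N f <= C * sup_norm f.
Hypothesis rho0 : rho xi sigma (idfun : {linear renormed N -> renormed N}) = 0.

Local Notation CBd := (derivative (@CB_derivative K)).
Local Notation level i := (CBd [set: K] (omul (oexp omega xi) (onat i))).

Let N_le (f : cfun K F) b : (forall k, `|f k| <= b) -> N f <= C * b.
Proof.
move=> fb; have /andP [_ Nf] := N_equiv f; apply: le_trans Nf _.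
by rewrite ler_wpM2l ?(ltW C_gt0)// (sup_norm_le e_le e_real K_nonempty).
Qed.

(** Chosen so that functions bounded by [s] have [N] at most [sigma]. *)
Let s := sigma / C.

Let s_gt0 : 0 < s. Proof. exact: divr_gt0. Qed.

(** Each descent by one level adds at least [s / 2] on a smaller open set that still meets the next
    level. The gap between [M0] and [M1] pays for the slack of all the steps. *)
Lemma flat_iterate (j : nat) (p : K) (V : set K) (M0 M1 h : F) (y : cfun K F) :
  level j p -> open V -> V p -> 1 <= M0 -> M0 < M1 -> N y <= M0 ->
  (forall k, V k -> h <= y k) ->
  exists (y' : cfun K F) q, N y' <= M1 /\ h + j%:R * (s / 2) <= y' q.
Proof.
elim: j p V M0 M1 h y => [|j IH] p V M0 M1 h y.
  move=> _ _ Vp _ /ltW M01 yM0 hy; exists y, p; split; first exact: le_trans M01.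
  by rewrite mul0r addr0; exact: hy.
rewrite omulS derivative_oadd => Lp oV Vp M0_ge1 M01 yM0 hy.
have M0_gt0 : 0 < M0 by exact: lt_le_trans ltr01 M0_ge1.
have [x [xs xnull xV]] :=
  bump_tree_ex e_le e_real K_compact K_hausdorff Lp oV Vp (ltW s_gt0).
(* Half of the remaining room is spent here; [M / M0 - 1] is the slack once [y] is rescaled to the
   unit ball. *)
pose M := (M0 + M1) / 2.
have M0M : M0 < M by rewrite ltr_pdivlMr// mulr_natr mulr2n ltrD2l.
have MM1 : M < M1 by rewrite ltr_pdivrMr// mulr_natr mulr2n ltrD2r.
have delta0 : 0 < M / M0 - 1 by rewrite subr_gt0 ltr_pdivlMr// mul1r.
have one0 : (mkcts (@cst_continuous K F 1) : renormed N) != 0.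
  apply/eqP => /(congr1 (fun f : cfun K F => f p)) /eqP.
  by rewrite /mkcts /= oner_eq0.
have y1 : `|M0^-1 *: (y : renormed N)| <= 1.
  by rewrite normrZ ger0_norm ?invr_ge0 ?(ltW M0_gt0)// ler_pdivrMl// mulr1.
have [|t [v [Tt vt]]] := rho_eq0_ex (X := renormed N) one0 rho0 y1
  (ordinal_tree_is_tree _)
  (ordinal_tree_order (oexp omega xi)) (x := x) _ (xnull N C N_le) delta0.
  move=> t Tt; apply: le_trans (N_le (xs t Tt)) _.
  by rewrite mulrC divfK// gt_eqF.
rewrite [1 + _]addrC subrK => yv.
have [V' [oV' V'V [q Lq V'q] V'x]] := xV t Tt.
have yvM : N (y + M0 *: (v : cfun K F)) <= M.
  rewrite -[y](scalerKV (lt0r_neq0 M0_gt0)) -scalerDr norm_scale ger0_norm//; last first.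
    exact: ltW.
  by rewrite mulrC -ler_pdivlMr//; exact: ltW.
have [k V'k|y' [q' [y'M1 hq']]] :=
  IH q V' M M1 (h + s / 2) (y + M0 *: (v : cfun K F)) Lq oV' V'q
    (le_trans M0_ge1 (ltW M0M)) MM1 yvM.
  rewrite cfunDE cfunZE lerD//; first exact/hy/V'V.
  (* Scaling back multiplies [v] by [M0], which is at least 1 and so keeps the lower bound
     [s / 2]. *)
  apply: (@le_trans _ _ (M0 * (s / 2))).
    by rewrite ler_peMl// divr_ge0// ltW.
  rewrite ler_wpM2l//; first exact: ltW.
  rewrite -[leLHS]mul1r; apply: weighted_sums_ge vt => g xg.
  exact: V'x.
exists y', q'; split=> //; apply: le_trans hq'.
by rewrite -addrA -[j.+1]addn1 natrD mulrDl mul1r [_ + s / 2]addrC.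
Qed.

Lemma flat_level_eq0 : exists n, level n = set0.
Proof.
apply: contrapT => /forallNP ne.
(* Chosen so that [n] increments of [s / 2] exceed [2 / c], which bounds the supremum norm of a
   function with [N] at most 2. *)
have [n Hn] : exists n : nat, 2 / c / (s / 2) + 1 <= n%:R.
  apply: (real_arch e_le e_real); rewrite ger0_real// addr_ge0//.
  by rewrite !divr_ge0// ltW.
have [p np] : level n !=set0 by apply/set0P/eqP.
have [||y [q [yM hq]]] := @flat_iterate n p setT 1 2 0 0 np openT Logic.I (lexx _)
  _ _ (fun _ _ => lexx _).
- by rewrite ltr1n.
- apply: le_trans (N_le (b := 0) _) _; last by rewrite mulr0.
  by move=> k; rewrite normr0.
have : c * `|y q| <= 2.
  apply: le_trans yM; have /andP [+ _] := N_equiv y; apply: le_trans.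
  by rewrite ler_wpM2l ?(ltW c_gt0)// (sup_norm_ge e_le e_real K_compact).
rewrite -ler_pdivlMl// mulrC => yq.
have sn0 : 0 <= n%:R * (s / 2) by rewrite mulr_ge0// divr_ge0// ltW.
rewrite add0r in hq; have yq0 := le_trans sn0 hq.
rewrite ger0_norm// in yq; have := le_trans hq yq.
rewrite -ler_pdivlMr ?divr_gt0// => /(le_trans Hn).
by rewrite gerDl lt_geF.
Qed.

End NotFlat.

(** * The index condition and the equivalence *)

(** [oexp omega (OSucc xi)] unfolds to the supremum of the finite multiples of [oexp omega xi], so
    lying strictly below it means lying strictly below one of them. *)
Lemma CB_index_lt_oexp_omegaS (K : topologicalType) (xi : ord) :
  CB_index_lt K (oexp omega (OSucc xi)) <->
  exists n, derivative (@CB_derivative K) [set: K]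
    (omul (oexp omega xi) (onat n)) = set0.
Proof.
split=> [[a [[Ka _] [n an]]]|[n Kn]].
  exists n; rewrite -subset0 -Ka.
  apply: derivative_anti (ole_trans (ole_succ a) an).
    exact: CB_derivative_sub.
  exact: CB_derivative_mono.
have [a [aK an]] := vanishes_first_ex Kn.
(* The index may equal the [n]-th multiple, hence [n.+1]. *)
exists a; split=> //; exists n.+1.
exact: ole_olt_trans an (olt_omulS n (oexp_omega_gt0 xi)).
Qed.

Lemma flat_norm_iff (R : realType) (F : numFieldType) (e : {rmorphism R -> F})
    (K : topologicalType) (xi : ord) :
  {mono e : a b / a <= b} ->
  (forall z : F, z \is Num.real -> exists a, z = e a) ->
  [set: K] !=set0 -> compact [set: K] -> hausdorff_space K ->
  (exists N : norm_on (cfun K F),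
      equivalent_norms N (@sup_norm K F) /\ auf_space xi (renormed N))
  <-> CB_index_lt K (oexp omega (OSucc xi)).
Proof.
move=> e_le e_real K0 cK hK; rewrite CB_index_lt_oexp_omegaS; split.
  move=> [N [[c [C [c0 C0 Nc]]] [sigma [sigma0 rho0]]]].
  exact: (flat_level_eq0 e_le e_real K0 cK hK c0 C0 sigma0 Nc rho0).
by move=> [n Kn]; exact: (flat_norm_ex e_le e_real K0 cK Kn).
Qed.

Theorem theorem1p2 (R : realType) (s : scalars) (K : topologicalType)
    (K_nonempty : [set: K] !=set0) (K_compact : compact [set: K])
    (K_hausdorff : hausdorff_space K) (xi : ord) :
  (exists N : norm_on (cfun K (scalar_field R s)),
      equivalent_norms N (@sup_norm K (scalar_field R s)) /\
      auf_space xi (renormed N))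
  <-> CB_index_lt K (oexp omega (OSucc xi)).
Proof.
case: s => /=.
  by apply: (@flat_norm_iff R R (idfun : {rmorphism R -> R})) => // z _; exists z.
apply: (@flat_norm_iff R R[i] (real_complex R)) => //.
  by move=> a b; rewrite lecR.
by move=> z /complex_realP.
Qed.
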